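(* For every $t\in\mathbb N$, the function $\overline L_t$ is VB-convex, where $\overline L_t(\mathrm{vec}(\rho))=L_t(\rho)$ and $$L_t(\rho):=\sum_{\tau=1}^t f_\tau(\rho)+\lambda R(\rho),\qquad f_\tau(\rho):=-\log\operatorname{tr}(A_\tau\rho),\qquad R(\rho):=-\log\det\rho,$$ with $\lambda>0$ and $A_1,\dots,A_t\in\mathbb C^{d\times d}$ Hermitian positive semidefinite matrices.
   Context: $f_\tau$ are the loss functions, and $R$ the negative log-determinant function, of density matrices $\rho$ (Hermitian positive semidefinite $d\times d$ complex matrices with unit trace), regarded as functions of Hermitian matrices. $\mathrm{vec}(M)$ is the vector in $\mathbb C^{d^2}$ formed by stacking the columns of $M$; the set of Hermitian $d\times d$ matrices with the Hilbert–Schmidt inner product is a finite-dimensional real Hilbert space. For a function $\varphi$ of Hermitian matrices, $\overline\varphi$ denotes the function with $\overline\varphi(\mathrm{vec}(M))=\varphi(M)$ for every Hermitian $M$. VB-convexity: let $\mathbb H$ be a real Hilbert space and $\varphi:\mathbb H\to\mathbb R$ a function with $\varphi\in C^4(\operatorname{dom}\varphi)$. Then $\varphi$ is VB-convex if it is strictly convex and $$D^4\varphi(x)[u,u,v,v]\;D^2\varphi(x)[v,v]\ \ge\ \tfrac32\left(D^3\varphi(x)[u,v,v]\right)^2\qquad\forall x\in\operatorname{dom}\varphi,\ u,v\in\mathbb H,$$ where $D^k\varphi(x)$ denotes the $k$-th derivative of $\varphi$ at $x$ as a multilinear form. *)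

(* Defs.v *)
From HB Require Import structures.
From mathcomp Require Import all_boot all_order all_algebra.
From mathcomp Require Import all_classical all_reals all_analysis.
From mathcomp Require Import complex ring.

Set Implicit Arguments.
Unset Strict Implicit.
Unset Printing Implicit Defensive.

Import Order.TTheory GRing.Theory Num.Theory Num.Def.
Import numFieldNormedType.Exports.

Local Open Scope classical_set_scope.
Local Open Scope ring_scope.
Local Open Scope complex_scope.
Local Open Scope sesquilinear_scope.

Section VBconvexity.
Context {R : realType} {V : normedModType R}.

(* [Dn f [:: u1; ..; uk] x] is D^k f(x)[u1,..,uk]: the Frechet derivative at x,
   in the direction u1, of y |-> D^(k-1) f(y)[u2,..,uk]. *)
Fixpoint Dn (f : V -> R) (us : seq V) : V -> R :=
  if us is u :: us' then fun x => 'd (Dn f us' : V -> R^o) x u else f.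

(* f is C^n on the open set D.  The last condition is continuity of D^n f for
   the operator norm of n-linear forms; by the mean value theorem it upgrades
   the differentiability of each y |-> D^k f(y)[us], k < n, to that of D^k f as
   a map into bounded k-linear forms. *)
Definition Cn (n : nat) (D : set V) (f : V -> R) : Prop :=
  [/\ open D,
      (forall x, D x -> forall us : seq V, (size us < n)%N ->
         differentiable (Dn f us : V -> R^o) x)
    & (forall x, D x -> forall e : R, 0 < e ->
         \forall y \near x, forall us : n.-tuple V,
           `|Dn f us y - Dn f us x| <= e * \prod_(u <- us) `|u|)].

Definition edom (phi : V -> \bar R) : set V := [set x | (phi x < +oo)%E].

Definition strictly_convex (phi : V -> \bar R) : Prop :=
  forall (x y : V) (s : R), edom phi x -> edom phi y -> x != y ->
    0 < s -> s < 1 ->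
    (phi (s *: x + (1 - s) *: y)%R < s%:E * phi x + (1 - s)%:E * phi y)%E.

(* As usual in convex analysis, a function with effective domain dom phi is a
   function to ]-oo, +oo] that is finite exactly on dom phi. *)
Definition VB_convex (phi : V -> \bar R) : Prop :=
  let D := Dn (fine \o phi) in
  [/\ (forall x, (-oo < phi x)%E),
      Cn 4 (edom phi) (fine \o phi),
      strictly_convex phi
    & (forall x u v : V, edom phi x ->
         D [:: u; u; v; v] x * D [:: v; v] x >=
           3 / 2 * (D [:: u; v; v] x) ^+ 2)].

End VBconvexity.

Section Matrices.
Context {R : realType}.
Local Notation C := R[i].

Definition psdmx n (A : 'M[C]_n) : Prop :=
  A \is hermsymmx /\ forall x : 'cV[C]_n, 0 <= (x ^t* *m A *m x) 0 0.

Definition pdmx n (A : 'M[C]_n) : Prop :=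
  A \is hermsymmx /\
  forall x : 'cV[C]_n, x != 0 -> 0 < (x ^t* *m A *m x) 0 0.

(* [mxvec] is row-major, hence the transposition. *)
Definition colvec n (M : 'M[C]_n) : 'cV[C]_(n * n) := (mxvec M^T)^T.
Definition uncolvec n (v : 'cV[C]_(n * n)) : 'M[C]_n := (vec_mx v^T)^T.

Lemma colvecK n : cancel (@colvec n) (@uncolvec n).
Proof. by move=> M; rewrite /uncolvec trmxK mxvecK trmxK. Qed.

Lemma uncolvecK n : cancel (@uncolvec n) (@colvec n).
Proof. by move=> M; rewrite /colvec trmxK vec_mxK trmxK. Qed.

Lemma uncolvec_is_linear n : linear (@uncolvec n).
Proof. by move=> a u v; rewrite /uncolvec !linearP. Qed.
HB.instance Definition _ n :=
  GRing.isLinear.Build C _ _ _ (@uncolvec n) (@uncolvec_is_linear n).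

Lemma hermsymmxP n (M : 'M[C]_n) :
  reflect (M ^t* = M) (M \is hermsymmx).
Proof.
by apply: (iffP (is_hermitianmxP _ _ _)); rewrite expr0 scale1r => /esym.
Qed.

Definition hermvec_pred n : {pred 'cV[C]_(n * n)} :=
  fun v => uncolvec v \is hermsymmx.

Fact hermvec_zmod_closed n : zmod_closed (@hermvec_pred n).
Proof.
split=> [|u v]; rewrite !unfold_in.
  by apply/hermsymmxP; rewrite linear0 trmx0 map_mx0.
move=> /hermsymmxP hu /hermsymmxP hv; apply/hermsymmxP.
by rewrite !linearB/= map_mxB hu hv.
Qed.
HB.instance Definition _ n :=
  GRing.isZmodClosed.Build _ (@hermvec_pred n) (@hermvec_zmod_closed n).

(* The real Hilbert space { vec M | M Hermitian }, with the real scalar action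
   and (below) the norm of the Hilbert-Schmidt inner product. *)
Definition hermvec n := {v : 'cV[C]_(n * n) | v \in @hermvec_pred n}.
HB.instance Definition _ n := [Choice of hermvec n by <:].
HB.instance Definition _ n := SubChoice.on (hermvec n).
HB.instance Definition _ n := [SubChoice_isSubZmodule of hermvec n by <:].

Fact hermvec_scale_subproof n (a : R) (v : hermvec n) :
  a%:C *: val v \in @hermvec_pred n.
Proof.
have /hermsymmxP hv := valP v; apply/hermsymmxP.
rewrite !linearZ/= map_mxZ /= hv; congr (_ *: _).
exact: conjc_real.
Qed.

Definition hermvec_scale n (a : R) (v : hermvec n) : hermvec n :=
  Sub (a%:C *: val v) (hermvec_scale_subproof a v).

Fact hermvec_scaleA n a b (v : hermvec n) :
  hermvec_scale a (hermvec_scale b v) = hermvec_scale (a * b) v.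
Proof. by apply: val_inj; rewrite /= scalerA rmorphM. Qed.

Fact hermvec_scale1 n : left_id 1 (@hermvec_scale n).
Proof. by move=> v; apply: val_inj; rewrite /= rmorph1 scale1r. Qed.

Fact hermvec_scaleDr n : right_distributive (@hermvec_scale n) +%R.
Proof. by move=> a u v; apply: val_inj; rewrite /= scalerDr. Qed.

Fact hermvec_scaleDl n (v : hermvec n) :
  {morph (@hermvec_scale n)^~ v : a b / a + b}.
Proof. by move=> a b; apply: val_inj; rewrite /= rmorphD scalerDl. Qed.

HB.instance Definition _ n := GRing.Zmodule_isLmodule.Build R (hermvec n)
  (@hermvec_scaleA n) (@hermvec_scale1 n) (@hermvec_scaleDr n)
  (@hermvec_scaleDl n).

Definition hvdot n (u v : hermvec n) : R :=
  complex.Re (((val u) ^t* *m val v) 0 0).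

Fact hvdotDl n (u v w : hermvec n) : hvdot (u + v) w = hvdot u w + hvdot v w.
Proof. by rewrite /hvdot/= linearD/= map_mxD mulmxDl mxE raddfD. Qed.

Fact hvdotZl n a (u v : hermvec n) : hvdot (a *: u) v = a * hvdot u v.
Proof.
rewrite /hvdot/= linearZ/= map_mxZ -scalemxAl mxE.
rewrite [X in complex.Re (X * _)](conjc_real a).
by case: (_ 0 0) => x y /=; rewrite mul0r subr0.
Qed.

Fact hvdotC n (u v : hermvec n) : hvdot u v = hvdot v u.
Proof.
rewrite /hvdot !mxE !raddf_sum; apply: eq_bigr => k _; rewrite !mxE.
case: (val u k 0) (val v k 0) => [a b] [c e] /=.
by rewrite !mulNr !opprK [c * a]mulrC [e * b]mulrC.
Qed.

Fact hvdot_sum n (u : hermvec n) : hvdot u u =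
  \sum_k (complex.Re (val u k 0) ^+ 2 + complex.Im (val u k 0) ^+ 2).
Proof.
rewrite /hvdot !mxE raddf_sum; apply: eq_bigr => k _; rewrite !mxE.
by case: (val u k 0) => [a b] /=; rewrite mulNr opprK -!expr2.
Qed.

Fact hvdot_ge0 n (u : hermvec n) : 0 <= hvdot u u.
Proof. by rewrite hvdot_sum sumr_ge0// => k _; rewrite addr_ge0 ?sqr_ge0. Qed.

Fact hvdot_eq0 n (u : hermvec n) : hvdot u u = 0 -> u = 0.
Proof.
move=> /eqP; rewrite hvdot_sum psumr_eq0; last first.
  by move=> k _; rewrite addr_ge0 ?sqr_ge0.
move=> /allP h; apply/val_inj/matrixP => k j; rewrite ord1 /= mxE.
have := h k (mem_index_enum _).
rewrite /= paddr_eq0 ?sqr_ge0// !sqrf_eq0.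
by case: (val u k 0) => a b /= /andP[/eqP -> /eqP ->].
Qed.

(* The inner product of [hermvec n] is the Hilbert-Schmidt one. *)
Lemma hvdotE n (u v : hermvec n) :
  (hvdot u v)%:C = \tr (uncolvec (val u) *m uncolvec (val v)).
Proof.
have hu : (uncolvec (val u)) ^t* = uncolvec (val u).
  exact/hermsymmxP/(valP u).
have hv : (uncolvec (val v)) ^t* = uncolvec (val v).
  exact/hermsymmxP/(valP v).
have E : ((val u) ^t* *m val v) 0 0 =
    \tr (uncolvec (val u) *m uncolvec (val v)).
  rewrite -hu mxE (reindex _ (curry_mxvec_bij n n))/= /mxtrace.
  transitivity (\sum_i \sum_j ((val u) ^t*) 0 (mxvec_index i j) *
      val v (mxvec_index i j) 0).
    by rewrite pair_bigA; apply: eq_bigr => -[].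
  by apply: eq_bigr => i _; rewrite mxE; apply: eq_bigr => j _; rewrite !mxE.
rewrite /hvdot E; apply/RRe_real/CrealP.
rewrite -trace_map_mx -mxtrace_tr map_trmx trmx_mul map_mxM hu hv.
exact: mxtrace_mulC.
Qed.

Definition hvnorm n (u : hermvec n) : R := Num.sqrt (hvdot u u).

Fact ler_hvnormD n (u v : hermvec n) : hvnorm (u + v) <= hvnorm u + hvnorm v.
Proof.
have expand a b (x y : hermvec n) : hvdot (a *: x + b *: y) (a *: x + b *: y) =
    a ^+ 2 * hvdot x x + 2 * (a * b) * hvdot x y + b ^+ 2 * hvdot y y.
  rewrite hvdotDl ![hvdot _ (a *: x + _)]hvdotC !hvdotDl !hvdotZl.
  by rewrite ![hvdot _ (_ *: _)]hvdotC !hvdotZl (hvdotC y x); ring.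
have [->|v0] := eqVneq v 0; first by rewrite addr0 lerDl sqrtr_ge0.
have vv : 0 < hvdot v v.
  rewrite lt_neqAle hvdot_ge0 andbT eq_sym; apply: contra v0 => /eqP h.
  by rewrite (hvdot_eq0 h).
have CS : hvdot u v ^+ 2 <= hvdot u u * hvdot v v.
  have := hvdot_ge0 (hvdot v v *: u + (- hvdot u v) *: v).
  rewrite expand (_ : _ + _ =
    hvdot v v * (hvdot u u * hvdot v v - hvdot u v ^+ 2)); last by ring.
  by rewrite pmulr_rge0// subr_ge0.
rewrite -(ler_pXn2r (ltn0Sn 1)) ?nnegrE ?addr_ge0 ?sqrtr_ge0//.
rewrite sqrrD !sqr_sqrtr ?hvdot_ge0//.
have -> : hvdot (u + v) (u + v) = hvdot u u + 2 * hvdot u v + hvdot v v.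
  by have := expand 1 1 u v; rewrite !scale1r => ->; ring.
rewrite lerD2r lerD2l mulr_natl lerMn2r/= -sqrtrM ?hvdot_ge0//.
by rewrite (le_trans (ler_norm _))// -sqrtr_sqr ler_wsqrtr.
Qed.

Fact hvnormZ n a (u : hermvec n) : hvnorm (a *: u) = `|a| * hvnorm u.
Proof.
rewrite /hvnorm hvdotZl hvdotC hvdotZl mulrA -expr2.
by rewrite sqrtrM ?sqr_ge0// sqrtr_sqr.
Qed.

Fact hvnorm0_eq0 n (u : hermvec n) : hvnorm u = 0 -> u = 0.
Proof.
move=> /eqP; rewrite sqrtr_eq0 => h; apply: hvdot_eq0.
by apply/eqP; rewrite eq_le h hvdot_ge0.
Qed.

HB.instance Definition _ n := Lmodule_isNormed.Build R (hermvec n)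
  (@ler_hvnormD n) (@hvnormZ n) (@hvnorm0_eq0 n).

Lemma hvnormE n (u : hermvec n) : `|u| ^+ 2 = hvdot u u.
Proof. by rewrite sqr_sqrtr ?hvdot_ge0. Qed.

Fact colvec_hermvec n (M : 'M[C]_n) :
  M \is hermsymmx -> colvec M \in @hermvec_pred n.
Proof. by move=> hM; rewrite unfold_in colvecK. Qed.

Definition hvec n (M : 'M[C]_n) (hM : M \is hermsymmx) : hermvec n :=
  Sub (colvec M) (colvec_hermvec hM).

Definition overline n (phi : 'M[C]_n -> \bar R) : hermvec n -> \bar R :=
  fun v => phi (uncolvec (val v)).

Lemma overlineE n (phi : 'M[C]_n -> \bar R) M (hM : M \is hermsymmx) :
  overline phi (hvec hM) = phi M.
Proof. by rewrite /overline/= colvecK. Qed.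

(* For A and rho Hermitian, tr(A rho) and det rho are real.  [lne] is -oo on
   nonpositive reals, so [log_loss A] is +oo where tr(A rho) <= 0; [neg_logdet]
   is +oo off the positive definite cone. *)
Definition log_loss n (A rho : 'M[C]_n) : \bar R :=
  (- lne (complex.Re (\tr (A *m rho)))%:E)%E.

Definition neg_logdet n (rho : 'M[C]_n) : \bar R :=
  if `[< pdmx rho >] then (- ln (complex.Re (\det rho)))%:E else +oo%E.

Definition cumulative_loss n t (A : 'I_t -> 'M[C]_n) (lambda : R)
    (rho : 'M[C]_n) : \bar R :=
  (\sum_(tau < t) log_loss (A tau) rho + lambda%:E * neg_logdet rho)%E.

End Matrices.

(* Main.v *)
(* A logarithm -ln tr(A rho) is -ln det of a 1 x 1 matrix, so every term of the
   loss is -ln det(L x) for a real-linear Hermitian matrix pencil L. With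
   P = (L x)^-1, its derivatives are signed sums of traces of words
   P L(u_1) P L(u_2) ..., and differentiating in the direction u inserts u into
   the words. Writing L x = B^* B turns P L(u), P L(v) into Hermitian matrices
   U, V (up to similarity), and with S = UV + VU, N = UV - VU
     s^2 D^4[u,u,v,v] + 3 s t D^3[u,v,v] + 3/2 t^2 D^2[v,v]
       = 3/2 tr((sS - tV)^2) - 1/2 s^2 tr(N^2) >= 0,
   since N is skew-Hermitian. This quadratic form in (s,t) is additive in the
   function, and its discriminant is the required inequality. Both
   differentiability of ln det and strict convexity come from the first-order
   inequality ln det Y <= ln det X + tr(X^-1 (Y - X)), which is strict for
   X <> Y. *)
From HB Require Import structures.
Require Import Defs.
From mathcomp Require Import all_boot all_order all_algebra.
From mathcomp Require Import all_classical all_reals all_analysis.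
From mathcomp Require Import complex ring lra.

Set Implicit Arguments.
Unset Strict Implicit.
Unset Printing Implicit Defensive.

Import Order.TTheory GRing.Theory Num.Theory.
Import numFieldNormedType.Exports.

Local Open Scope ring_scope.
Local Open Scope complex_scope.
Local Open Scope sesquilinear_scope.

(** * Hermitian and positive definite matrices *)

Section HermitianMatrices.
Context {R : realType}.
Local Notation C := R[i].
Implicit Types n : nat.

Lemma conjtrM m n p (A : 'M[C]_(m, n)) (B : 'M[C]_(n, p)) :
  (A *m B) ^t* = B ^t* *m A ^t*.
Proof. by rewrite trmx_mul map_mxM. Qed.

Lemma conjtrD m n (A B : 'M[C]_(m, n)) : (A + B) ^t* = A ^t* + B ^t*.
Proof. by rewrite linearD map_mxD. Qed.

Lemma conjtrB m n (A B : 'M[C]_(m, n)) : (A - B) ^t* = A ^t* - B ^t*.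
Proof. by rewrite linearB map_mxB. Qed.

Lemma conjtrZ {m n} (a : R) (A : 'M[C]_(m, n)) :
  (a%:C *: A) ^t* = a%:C *: A ^t*.
Proof. by rewrite linearZ map_mxZ; congr (_ *: _); exact: conjc_real. Qed.

Lemma conjtr_inv n (A : 'M[C]_n) : (invmx A) ^t* = invmx (A ^t*).
Proof. by rewrite trmx_inv map_invmx. Qed.

Lemma conjtr_unit n (A : 'M[C]_n) : (A ^t* \in unitmx) = (A \in unitmx).
Proof. by rewrite map_unitmx unitmx_tr. Qed.

Lemma invmxM n (A B : 'M[C]_n) : A \in unitmx -> B \in unitmx ->
  invmx (A *m B) = invmx B *m invmx A.
Proof.
move=> uA uB; have uAB : A *m B \in unitmx by rewrite unitmx_mul uA.
rewrite -[LHS]mulmx1 -(mulmxV uA) mulmxA; congr (_ *m _).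
rewrite -[LHS]mulmx1 -(mulmxV uB) mulmxA -[_ *m A *m B]mulmxA mulVmx//.
by rewrite mul1mx.
Qed.

Lemma conjtr_mul_sum m n (A : 'M[C]_(m, n)) i :
  (A ^t* *m A) i i = \sum_k `|A k i| ^+ 2.
Proof.
rewrite mxE; apply: eq_bigr => k _; by rewrite !mxE [RHS]normCK mulrC.
Qed.

Lemma conjtr_mul_ge0 n (x : 'cV[C]_n) : 0 <= (x ^t* *m x) 0 0.
Proof. by rewrite conjtr_mul_sum sumr_ge0// => k _; rewrite exprn_ge0. Qed.

Lemma conjtr_mul_gt0 n (x : 'cV[C]_n) : x != 0 -> 0 < (x ^t* *m x) 0 0.
Proof.
move=> x0; rewrite lt_neqAle conjtr_mul_ge0 andbT eq_sym.
apply: contra x0; rewrite conjtr_mul_sum psumr_eq0; last first.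
  by move=> k _; rewrite exprn_ge0.
move=> /allP h; apply/eqP/matrixP => k j; rewrite ord1 mxE.
have /= := h k (mem_index_enum _).
by rewrite expf_eq0/= normr_eq0 => /eqP.
Qed.

Lemma pdmx_conjtr_mul n (A : 'M[C]_n) : A \in unitmx -> pdmx (A ^t* *m A).
Proof.
move=> uA; split; first by apply/hermsymmxP; rewrite conjtrM trmxCK.
move=> x x0; rewrite mulmxA -conjtrM -mulmxA.
apply: conjtr_mul_gt0; apply: contra x0 => /eqP Ax.
by rewrite -[x](mulKmx uA) Ax mulmx0.
Qed.

(** The spectral theorem, with the eigenvalues stored as reals so that they can be compared with 0
    and fed to [ln]. *)
Lemma hermsymmx_diag n (Y : 'M[C]_n) : Y \is hermsymmx ->
  exists (Q : 'M[C]_n) (mu : 'rV[R]_n),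
    Q \is unitarymx /\
    Y = Q ^t* *m diag_mx (map_mx (real_complex R) mu) *m Q.
Proof.
move=> hY; exists (spectralmx Y), (map_mx (@complex.Re R) (spectral_diag Y)).
split; first exact: spectral_unitarymx.
have <- : spectral_diag Y =
    map_mx (real_complex R) (map_mx (@complex.Re R) (spectral_diag Y)).
  apply/matrixP => i j; rewrite !mxE RRe_real//.
  by have /mxOverP := hermitian_spectral_diag_real hY; apply.
rewrite -(invmx_unitary (spectral_unitarymx Y)).
exact/orthomx_spectralP/hermitian_normalmx.
Qed.

(** The Hermitian form takes the value [mu 0 k] at the eigenvector [Q ^t* *m e_k]. *)
Lemma unitary_diag_gt0 n (Q : 'M[C]_n) (mu : 'rV[R]_n) : Q \is unitarymx ->
  pdmx (Q ^t* *m diag_mx (map_mx (real_complex R) mu) *m Q) ->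
  forall k, 0 < mu 0 k.
Proof.
move=> uQ [_ pd] k.
pose x : 'cV[C]_n := Q ^t* *m delta_mx k 0.
have QQ : Q *m Q ^t* = 1%:M by apply/unitarymxP.
have x0 : x != 0.
  apply/eqP => /(congr1 (mulmx Q)); rewrite /x mulmxA QQ mul1mx mulmx0.
  by move=> /matrixP/(_ k 0); rewrite !mxE !eqxx => /eqP; rewrite oner_eq0.
have := pd x x0; rewrite /x conjtrM trmxCK !mulmxA.
rewrite -[_ *m Q *m Q ^t*]mulmxA QQ mulmx1.
rewrite -[_ *m Q *m Q ^t*]mulmxA QQ mulmx1 -colE.
have -> : (delta_mx k 0 : 'cV[C]_n) ^t* = delta_mx 0 k.
  by rewrite trmx_delta map_delta_mx.
by rewrite -rowE !mxE eqxx mulr1n ltcR.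
Qed.

Lemma pdmx_decomp n (X : 'M[C]_n) : pdmx X ->
  exists2 B, B \in unitmx & X = B ^t* *m B.
Proof.
move=> pdX; have [hX _] := pdX.
have [Q [mu [uQ eX]]] := hermsymmx_diag hX.
have mu_gt0 k : 0 < mu 0 k.
  by move: k; apply: unitary_diag_gt0 uQ _; rewrite -eX.
pose D := diag_mx (map_mx (fun a => (Num.sqrt a)%:C) mu) : 'M[C]_n.
have DD : D ^t* *m D = diag_mx (map_mx (real_complex R) mu).
  rewrite /D tr_diag_mx map_diag_mx mulmx_diag; congr diag_mx.
  apply/matrixP => i j; rewrite !mxE [X in X * _](conjc_real _) -rmorphM/=.
  by rewrite -expr2 sqr_sqrtr ?ord1// ltW.
exists (D *m Q).
  rewrite unitmx_mul [X in _ && X]unitarymx_unit// andbT.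
  rewrite unitmxE det_diag unitfE.
  apply/prodf_neq0 => k _; rewrite mxE.
  by rewrite gt_eqF// ltcR sqrtr_gt0.
by rewrite conjtrM mulmxA -[Q ^t* *m _ *m D]mulmxA DD.
Qed.

Lemma pdmx_unit n (X : 'M[C]_n) : pdmx X -> X \in unitmx.
Proof.
by move=> /pdmx_decomp[B uB ->]; rewrite unitmx_mul conjtr_unit uB.
Qed.

(** Factor X = B0^* B0 and Y = B1^* B1, and diagonalise B2^* B2 for B2 = B1 B0^-1 by a unitary Q.
    Then B = Q B0 serves both matrices, since Q disappears from B^* B. *)
Lemma pdmx_codiag n (X Y : 'M[C]_n) : pdmx X -> pdmx Y ->
  exists (B : 'M[C]_n) (mu : 'rV[R]_n),
    [/\ B \in unitmx, forall k, 0 < mu 0 k, X = B ^t* *m B &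
      Y = B ^t* *m diag_mx (map_mx (real_complex R) mu) *m B].
Proof.
move=> /pdmx_decomp[B0 uB0 ->] pdY.
have [B1 uB1 eY] := pdmx_decomp pdY.
pose B2 := B1 *m invmx B0.
have uB2 : B2 \in unitmx by rewrite unitmx_mul uB1 unitmx_inv.
have pd2 := pdmx_conjtr_mul uB2.
have [Q [mu [uQ e2]]] := hermsymmx_diag pd2.1.
exists (Q *m B0), mu; split.
- by rewrite unitmx_mul uB0 unitarymx_unit.
- by apply: (unitary_diag_gt0 uQ); rewrite -e2.
- rewrite conjtrM mulmxA -[_ *m Q ^t* *m Q]mulmxA.
  have := uQ; rewrite -trmxC_unitary => /unitarymxP; rewrite trmxCK => ->.
  by rewrite mulmx1.
rewrite conjtrM !mulmxA.
rewrite (_ : B0 ^t* *m _ *m _ *m Q = B0 ^t* *m (B2 ^t* *m B2)); last first.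
  by rewrite e2 !mulmxA.
by rewrite /B2 eY !mulmxA -conjtrM -!mulmxA mulVmx// !mulmx1.
Qed.

Lemma ReZ (a : R) (z : C) : complex.Re (a%:C * z) = a * complex.Re z.
Proof. by case: z => x y /=; rewrite mul0r subr0. Qed.

Lemma Re_tr_sqr_ge0 n (H : 'M[C]_n) : H ^t* = H ->
  0 <= complex.Re (\tr (H *m H)).
Proof.
move=> hH; rewrite -{1}hH /mxtrace raddf_sum sumr_ge0// => i _.
have : 0 <= (H ^t* *m H) i i.
  by rewrite conjtr_mul_sum sumr_ge0// => k _; rewrite exprn_ge0.
by rewrite lecE => /andP[_].
Qed.

Lemma Re_tr_sqr_le0 n (H : 'M[C]_n) : H ^t* = - H ->
  complex.Re (\tr (H *m H)) <= 0.
Proof.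
move=> hH; rewrite -[X in X *m H]opprK -hH mulNmx raddfN raddfN oppr_le0.
rewrite /mxtrace raddf_sum sumr_ge0// => i _.
have : 0 <= (H ^t* *m H) i i.
  by rewrite conjtr_mul_sum sumr_ge0// => k _; rewrite exprn_ge0.
by rewrite lecE => /andP[_].
Qed.

(** The weak bound at the square root r of a gives ln a = 2 ln r <= 2 (r - 1) = a - 1 - (r - 1)^2,
    and the last square is positive. *)
Lemma ln_lt_sub1 (a : R) : 0 < a -> a != 1 -> ln a < a - 1.
Proof.
move=> a0 a1; have s0 : 0 < Num.sqrt a by rewrite sqrtr_gt0.
have sa : Num.sqrt a ^+ 2 = a by rewrite sqr_sqrtr// ltW.
have s1 : Num.sqrt a != 1 by apply: contra a1 => /eqP e; rewrite -sa e expr1n.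
have := @le_ln1Dx _ (Num.sqrt a - 1); rewrite [1 + _]addrC subrK.
have -> : ln a = ln (Num.sqrt a) *+ 2 by rewrite -lnXn// sa.
move=> /(_ ltac:(lra)) h.
have : 0 < (Num.sqrt a - 1) ^+ 2 by rewrite exprn_even_gt0//= subr_eq0.
by rewrite -[X in _ < X - 1]sa mulr2n; nra.
Qed.

Lemma ln_le_sub1 (a : R) : 0 < a -> ln a <= a - 1.
Proof.
move=> a0; have := @le_ln1Dx _ (a - 1); rewrite [1 + _]addrC subrK.
by apply; lra.
Qed.

Lemma ln_prod (I : finType) (F : I -> R) : (forall i, 0 < F i) ->
  ln (\prod_i F i) = \sum_i ln (F i).
Proof.
move=> F0.
suff [] : 0 < \prod_i F i /\ ln (\prod_i F i) = \sum_i ln (F i) by [].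
elim/big_ind2 : _ => [|x1 x2 y1 y2 [p1 <-] [p2 <-]|i _]; rewrite ?ltr01 ?ln1//.
by rewrite mulr_gt0 ?lnM.
Qed.

Lemma det_conjtr_mul n (B : 'M[C]_n) : B \in unitmx ->
  exists2 c : R, 0 < c & \det (B ^t*) * \det B = c%:C.
Proof.
rewrite unitmxE unitfE => uB.
have e : \det (B ^t*) * \det B = `|\det B| ^+ 2.
  by rewrite det_map_mx det_tr normCK mulrC.
have p : 0 < \det (B ^t*) * \det B by rewrite e exprn_gt0// normr_gt0.
exists (complex.Re (\det (B ^t*) * \det B)).
  by move: p; rewrite ltcE => /andP[].
by rewrite RRe_real// realE ltW.
Qed.

(* After simultaneous diagonalisation this is [ln mu <= mu - 1], summed over the
   eigenvalues mu of Y relative to X. *)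
Lemma ln_det_le n (X Y : 'M[C]_n) : pdmx X -> pdmx Y ->
  [/\ 0 < complex.Re (\det X),
      ln (complex.Re (\det Y)) <= ln (complex.Re (\det X)) +
        complex.Re (\tr (invmx X *m (Y - X))) &
      X != Y -> ln (complex.Re (\det Y)) < ln (complex.Re (\det X)) +
        complex.Re (\tr (invmx X *m (Y - X)))].
Proof.
move=> pdX pdY; have [B [mu [uB mu0 eX eY]]] := pdmx_codiag pdX pdY.
have [c c0 ec] := det_conjtr_mul uB.
have dX : \det X = c%:C by rewrite eX det_mulmx ec.
have dY : \det Y = (c * \prod_k mu 0 k)%:C.
  rewrite eY !det_mulmx mulrAC ec det_diag rmorphM rmorph_prod.
  by congr (_ * _); apply: eq_bigr => k _; rewrite mxE.
(* X^-1 Y is similar to the diagonal matrix of mu. *)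
have trE : complex.Re (\tr (invmx X *m (Y - X))) = \sum_k (mu 0 k - 1).
  rewrite mulmxBr mulVmx ?pdmx_unit// raddfB/= raddfB/= sumrB; congr (_ - _).
    have iX : invmx X = invmx B *m invmx (B ^t*).
      by rewrite eX invmxM ?conjtr_unit.
    rewrite iX eY !mulmxA mxtrace_mulC !mulmxA mulmxV// mul1mx.
    rewrite mulVmx ?conjtr_unit// mul1mx mxtrace_diag raddf_sum.
    by apply: eq_bigr => k _; rewrite mxE.
  by rewrite mxtrace1 sumr_const card_ord raddfMn.
have prod0 : 0 < \prod_k mu 0 k by apply: prodr_gt0.
rewrite dX dY trE/= lnM ?posrE// ln_prod//.
split=> //.
  by rewrite lerD2l ler_sum// => k _; exact: ln_le_sub1.
move=> XY.
(* If every relative eigenvalue were 1, both factorisations would coincide and X = Y. *)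
have [k mk] : exists k, mu 0 k != 1.
  apply/existsP; apply: contraT; rewrite negb_exists => /forallP h.
  case/negP: XY; rewrite eX eY; apply/eqP; congr (_ *m _).
  rewrite -[LHS]mulmx1; congr (_ *m _).
  apply/matrixP => i j; rewrite !mxE.
  by have := h i; rewrite negbK => /eqP ->.
rewrite ltrD2l (bigD1 k)//= [X in _ < X](bigD1 k)//=.
rewrite ltr_leD ?ln_lt_sub1// ler_sum// => i _; exact: ln_le_sub1.
Qed.
End HermitianMatrices.

(** * Entrywise norm of complex matrices *)

Section MatrixNorm.
Context {R : realType}.
Local Notation C := R[i].
Local Notation normc := (@ComplexField.Normc.normc R).
Implicit Types n : nat.

(** The entrywise l1 norm with values in R: it is submultiplicative and controls both traces and
    Hermitian forms. *)
Definition mnorm m n (A : 'M[C]_(m, n)) : R := \sum_i \sum_j normc (A i j).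

Lemma normc_ge0 (z : C) : 0 <= normc z.
Proof. by case: z => a b; exact: sqrtr_ge0. Qed.

Lemma normcE (z : C) : (normc z)%:C = `|z|.
Proof. by []. Qed.

Lemma mnorm_ge0 m n (A : 'M[C]_(m, n)) : 0 <= mnorm A.
Proof. by do 2!apply: sumr_ge0 => ? _; exact: normc_ge0. Qed.

Lemma mnormD m n (A B : 'M[C]_(m, n)) : mnorm (A + B) <= mnorm A + mnorm B.
Proof.
rewrite -big_split ler_sum//= => i _; rewrite -big_split ler_sum//= => j _.
by rewrite mxE le_normcD.
Qed.

Lemma mnormN m n (A : 'M[C]_(m, n)) : mnorm (- A) = mnorm A.
Proof.
by apply: eq_bigr => i _; apply: eq_bigr => j _; rewrite mxE normcN.
Qed.

Lemma mnorm0 m n : mnorm (0 : 'M[C]_(m, n)) = 0.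
Proof.
rewrite /mnorm big1// => i _; rewrite big1// => j _.
by rewrite mxE ComplexField.Normc.normc0.
Qed.

Lemma mnorm_sum m n I (r : seq I) (F : I -> 'M[C]_(m, n)) :
  mnorm (\sum_(i <- r) F i) <= \sum_(i <- r) mnorm (F i).
Proof.
elim/big_ind2 : _ => [|A a B b hA hB|//]; first by rewrite mnorm0.
by rewrite (le_trans (mnormD _ _)) ?lerD.
Qed.

Lemma normc_sum I (r : seq I) (F : I -> C) :
  normc (\sum_(i <- r) F i) <= \sum_(i <- r) normc (F i).
Proof.
rewrite -lecR rmorph_sum; exact: (@ler_norm_sum C C _ r F xpredT).
Qed.

Lemma mnormM m n p (A : 'M[C]_(m, n)) (B : 'M[C]_(n, p)) :
  mnorm (A *m B) <= mnorm A * mnorm B.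
Proof.
rewrite /mnorm mulr_suml ler_sum// => i _.
apply: (@le_trans _ _ (\sum_k \sum_j normc (A i j) * normc (B j k))).
  apply: ler_sum => k _; rewrite mxE (le_trans (normc_sum _ _))//.
  by apply: ler_sum => j _; rewrite ComplexField.Normc.normcM.
rewrite exchange_big/= mulr_suml ler_sum// => j _; rewrite -mulr_sumr.
rewrite ler_wpM2l ?normc_ge0// [leRHS](bigD1 j)//= lerDl.
by do 2!apply: sumr_ge0 => ? _; exact: normc_ge0.
Qed.

Lemma normr_Re_tr_le n (A : 'M[C]_n) : `|complex.Re (\tr A)| <= mnorm A.
Proof.
rewrite -lecR (le_trans (normc_ge_Re _))// /mxtrace.
rewrite (le_trans (ler_norm_sum _ _ _))//.
rewrite /mnorm rmorph_sum/= ler_sum// => i _.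
rewrite -normcE lecR (bigD1 i)//= lerDl.
by apply: sumr_ge0 => ? _; exact: normc_ge0.
Qed.

Lemma pdmx_congr n (B Z : 'M[C]_n) : B \in unitmx -> pdmx Z ->
  pdmx (B ^t* *m Z *m B).
Proof.
move=> uB [/hermsymmxP hZ pZ]; split.
  by apply/hermsymmxP; rewrite !conjtrM trmxCK hZ mulmxA.
move=> x x0; rewrite !mulmxA -conjtrM -[_ *m B *m x]mulmxA; apply: pZ.
by apply: contra x0 => /eqP Bx; rewrite -[x](mulKmx uB) Bx mulmx0.
Qed.

(** Each product |x_i| |x_j| is at most the squared length of x, because |x_i|^2 and |x_j|^2 are. *)
Lemma normr_form_le n (E : 'M[C]_n) (x : 'cV[C]_n) :
  `|(x ^t* *m E *m x) 0 0| <= (mnorm E)%:C * (x ^t* *m x) 0 0.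
Proof.
have s0 := conjtr_mul_ge0 x; set s := (x ^t* *m x) 0 0 in s0 *.
have xs k : `|x k 0| ^+ 2 <= s.
  by rewrite /s conjtr_mul_sum (bigD1 k)//= lerDl sumr_ge0.
have xx i j : `|x i 0| * `|x j 0| <= s.
  rewrite -(@ler_pXn2r _ 2)// ?nnegrE ?mulr_ge0// exprMn [s ^+ 2]expr2.
  by rewrite ler_pM// exprn_ge0.
rewrite -mulmxA mxE (le_trans (ler_norm_sum _ _ _))//.
rewrite /mnorm rmorph_sum mulr_suml ler_sum// => i _.
rewrite !mxE normrM norm_conjC.
rewrite (le_trans (ler_wpM2l _ (ler_norm_sum _ _ _)))//.
rewrite rmorph_sum mulr_suml mulr_sumr ler_sum// => j _.
by rewrite normrM mulrCA -normcE ler_wpM2l// normcE.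
Qed.

(** With X = B^* B, the matrix X + E is congruent to 1 + E' for a Hermitian E' that has norm below 1
    once E is small. *)
Lemma pdmx_perturb n (X : 'M[C]_n) : pdmx X -> exists2 r : R, 0 < r &
  forall E, E ^t* = E -> mnorm E < r -> pdmx (X + E).
Proof.
move=> /pdmx_decomp[B uB ->].
have uB' : B ^t* \in unitmx by rewrite conjtr_unit.
set k := mnorm (invmx (B ^t*)) * mnorm (invmx B).
have k0 : 0 <= k by rewrite mulr_ge0 ?mnorm_ge0.
(* The added 1 keeps the radius meaningful when [k] is 0, as happens for n = 0. *)
exists (k + 1)^-1; first by rewrite invr_gt0; lra.
move=> E hE Er; pose E' := invmx (B ^t*) *m E *m invmx B.
have -> : B ^t* *m B + E = B ^t* *m (1%:M + E') *m B.
  by rewrite mulmxDr mulmxDl mulmx1 /E' !mulmxA mulmxV// mul1mx mulmxKV.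
apply: pdmx_congr => //.
have hE' : E' ^t* = E'.
  by rewrite /E' !conjtrM hE !conjtr_inv trmxCK mulmxA.
have E'1 : mnorm E' < 1.
  apply: (@le_lt_trans _ _ (k * mnorm E)).
    rewrite (le_trans (mnormM _ _))// /k mulrAC ler_wpM2r ?mnorm_ge0//.
    exact: mnormM.
  apply: (@le_lt_trans _ _ ((k + 1) * mnorm E)).
    by rewrite ler_wpM2r ?mnorm_ge0//; lra.
  by rewrite mulrC -ltr_pdivlMr ?mul1r//; lra.
clearbody E'.
have h1E : (1%:M + E') ^t* = 1%:M + E'.
  by rewrite conjtrD hE' trmx1 map_mx1.
split; first exact/hermsymmxP.
move=> x x0; have s0 := conjtr_mul_gt0 x0.
rewrite mulmxDr mulmx1 mulmxDl mxE.
set e := (x ^t* *m E' *m x) 0 0.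
(* The order on C is partial; bounding [- e] by its modulus requires that [e] be real. *)
have er : e \is Num.real.
  apply/CrealP; rewrite /e.
  have : (x ^t* *m E' *m x) ^t* = x ^t* *m E' *m x.
    by rewrite !conjtrM hE' trmxCK mulmxA.
  by move=> /matrixP/(_ 0 0) {2}<-; rewrite !mxE.
have le_e : `|- e| < (x ^t* *m x) 0 0.
  rewrite normrN (le_lt_trans (normr_form_le _ _))//.
  by rewrite gtr_pMl// ltcR.
rewrite -[e]opprK subr_gt0 (le_lt_trans _ le_e)// real_ler_norm//.
by rewrite realN.
Qed.

End MatrixNorm.

(** * Derivatives of the log-determinant of a Hermitian pencil *)

Section QuadraticRemainder.
Context {R : realType} {V : normedModType R}.

Lemma near_dist_lt (x : V) (r : R) : 0 < r -> \forall y \near x, `|y - x| < r.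
Proof.
by move=> r0; apply/nbhs_normP; exists r => // y /=; rewrite distrC.
Qed.

(** A remainder of second order is o(h). The bound on [df] supplies its continuity, since V may be
    infinite-dimensional. *)
Lemma is_diff_quadratic (f df : V -> R) (x : V) :
  linear_for *%R df ->
  (exists K, forall h, `|df h| <= K * `|h|) ->
  (exists K, \forall y \near x,
    `|f y - f x - df (y - x)| <= K * `|y - x| ^+ 2) ->
  is_diff x (f : V -> R^o) df.
Proof.
move=> lin [K1 hK1] [K2 hK2].
pose dfl := GRing.isLinear.Build R V R^o *:%R df lin.
pose g : {linear V -> R^o} := HB.pack df dfl.
have gc : continuous g.
  apply/linear_bounded_continuous/linear_boundedP.
  exists K1; split; first exact: num_real.
  by move=> r /ltW K1r h; rewrite (le_trans (hK1 h))// ler_wpM2r.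
have H : (f : V -> R^o) \o shift x = cst (f x) + g +o_ 0 id.
  apply/eqaddoP => e e0.
  rewrite near_simpl; move: hK2; rewrite (near_shift 0 x) subr0 => hK2.
  near=> h.
  have -> : (((f : V -> R^o) \o shift x) - (cst (f x) + g)) h =
      f (h + x) - f x - df (h + x - x).
    by rewrite /= addrK opprD addrA.
  have hK : `|f (h + x) - f x - df (h + x - x)| <= K2 * `|h| ^+ 2.
    by rewrite -[in leRHS](addrK x h); near: h.
  rewrite (le_trans hK)// expr2 mulrA ler_wpM2r//.
  (* [K2] has no known sign, so it is replaced by a positive constant before dividing. *)
  rewrite (@le_trans _ _ ((`|K2| + 1) * `|h|))//.
    by rewrite ler_wpM2r// (le_trans (ler_norm _))// lerDl.
  have K0 : 0 < `|K2| + 1 by rewrite ltr_wpDl.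
  rewrite mulrC -ler_pdivlMr// -[h]subr0 ltW//.
  by near: h; apply: near_dist_lt; rewrite divr_gt0.
have dE := diff_unique gc H.
split; last exact: dE.
by apply/diff_locallyP; rewrite dE.
Unshelve. all: by end_near. Qed.

End QuadraticRemainder.

(** * Words in a Hermitian pencil and their first-order expansions *)

Section Pencil.
Context {R : realType} {V : normedModType R} {n : nat}.
Implicit Types (L : V -> 'M[R[i]]_n) (x y u v : V) (us ws : seq V).

Definition hermitian_pencil L := [/\ linear_for (real_complex R \; *:%R) L,
  forall v, L v ^t* = L v &
  exists2 K, 0 <= K & forall v, mnorm (L v) <= K * `|v|].

Definition word L x ws : 'M[R[i]]_n :=
  foldr (fun v B => invmx (L x) *m L v *m B) 1%:M ws.

(* As the derivative of P = (L x)^-1 in the direction u is - P L(u) P, that of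
   a word is minus the sum of its insertions of u. *)
Fixpoint insertions u ws : seq (seq V) :=
  if ws is v :: ws' then
    (u :: v :: ws') :: [seq v :: w | w <- insertions u ws']
  else [::].

(** The recursion starts at one letter because D(-ln det)[u] is minus the trace of the word u.
    Insertion never happens after the last letter, so every word ends with the last direction, and
    each cyclic order of the directions occurs exactly once: (k-1)! words for k directions. *)
Fixpoint words us : seq (seq V) :=
  match us with
  | [::] => [::]
  | [:: u] => [:: [:: u]]
  | u :: us' => flatten [seq insertions u w | w <- words us']
  end.

Definition logdetD L us x : R :=
  if us is [::] then - ln (complex.Re (\det (L x)))
  else (-1) ^+ size us * \sum_(w <- words us) complex.Re (\tr (word L x w)).

Lemma words_cons u us : us != [::] ->
  words (u :: us) = flatten [seq insertions u w | w <- words us].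
Proof. by case: us. Qed.

Lemma perm_insertions u ws w : w \in insertions u ws -> perm_eq w (u :: ws).
Proof.
elim: ws w => [//|v ws IH] w /=; rewrite inE => /predU1P[-> //|].
case/mapP => w' /IH pw' ->.
rewrite -[u :: v :: ws]/([:: u] ++ [:: v] ++ ws) perm_sym perm_catCA/=.
by rewrite perm_cons perm_sym.
Qed.

Lemma size_insertions u ws : size (insertions u ws) = size ws.
Proof. by elim: ws => //= v ws IH; rewrite size_map IH. Qed.

Lemma perm_words us w : w \in words us -> perm_eq w us.
Proof.
elim: us w => [//|u [|v us] IH] w; first by rewrite inE => /eqP ->.
rewrite words_cons// => /flattenP[ws /mapP[w' /IH pw' ->]].
by move=> /perm_insertions/permPl ->; rewrite perm_cons.
Qed.

Lemma size_words us : us != [::] -> size (words us) = ((size us).-1)`!.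
Proof.
elim: us => // u [//|v us] IH _; rewrite words_cons// size_flatten /shape.
rewrite -map_comp (_ : map _ _ = nseq (size (words (v :: us))) (size us).+1).
  by rewrite sumn_nseq IH//= mulnC factS.
rewrite -(size_map (size \o insertions u)).
apply/all_pred1P/allP => _ /mapP[w hw ->].
by rewrite /= size_insertions (perm_size (perm_words hw)).
Qed.

Lemma subr_mulmx3 (K : comNzRingType) m (P P' X W W' : 'M[K]_m) :
  P' *m X *m W' - P *m X *m W = (P' - P) *m X *m W +
    (P' - P) *m X *m (W' - W) + P *m X *m (W' - W).
Proof.
rewrite -mulmxDr [W + _]addrC subrK.
by rewrite mulmxBr !mulmxBl addrA subrK.
Qed.

(** A discrete Leibniz rule. The hypothesis expands the inverse P' to second order around P, and S
    is minus the first-order change of the tail W. After adding the two first-order terms, every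
    term on the right is of second order. *)
Lemma word_remainder (K : comNzRingType) m (P P' E X W W' S : 'M[K]_m) :
  P *m E *m (P' - P) = - (P' - P + P *m E *m P) ->
  P' *m X *m W' - P *m X *m W + (P *m E *m (P *m X *m W) + P *m X *m S) =
  P *m X *m (W' - W + S) - P *m E *m (P' - P) *m X *m W +
    (P' - P) *m X *m (W' - W).
Proof.
move=> ->; rewrite !mulNmx opprK !mulmxDl !mulmxDr !mulmxN !mulNmx !mulmxA opprK.
(* With the noncommutative monomials as atoms, the identity is purely additive and can be checked
   entrywise. *)
set a1 := P' *m X *m W'; set a2 := P *m X *m W; set a3 := P *m X *m S.
set a4 := P *m E *m P *m X *m W; set a5 := P *m X *m W'; set a6 := P' *m X *m W.
move: a1 a2 a3 a4 a5 a6 => a1 a2 a3 a4 a5 a6.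
by apply/matrixP => i j; rewrite !mxE; ring.
Qed.

Section Fixed.
Variables (L : V -> 'M[R[i]]_n) (hL : hermitian_pencil L).

Lemma pencilD u v : L (u + v) = L u + L v.
Proof.
by have [lin _ _] := hL; rewrite -[u]scale1r lin /= rmorph1 !scale1r.
Qed.

Lemma pencil0 : L 0 = 0.
Proof. by apply: (addrI (L 0)); rewrite -pencilD !addr0. Qed.

Lemma pencilZ a u : L (a *: u) = a%:C *: L u.
Proof. by have [lin _ _] := hL; rewrite -[a *: u]addr0 lin pencil0 addr0. Qed.

Lemma pencilN u : L (- u) = - L u.
Proof. by apply: (addrI (L u)); rewrite -pencilD !subrr pencil0. Qed.

Lemma pencilB u v : L (u - v) = L u - L v.
Proof. by rewrite pencilD pencilN. Qed.

Lemma pencil_near x : pdmx (L x) -> \forall y \near x, pdmx (L y).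
Proof.
move=> /pdmx_perturb[r r0 hr]; have [_ herm [K K0 bd]] := hL.
have r1 : 0 < r / (K + 1) by rewrite divr_gt0// ltr_wpDl.
apply: filterS (near_dist_lt x r1) => y yx.
rewrite -[y](subrK x) addrC pencilD; apply: hr => //.
rewrite (le_lt_trans (bd _))// (@le_lt_trans _ _ ((K + 1) * `|y - x|))//.
  by rewrite ler_wpM2r// lerDl.
by rewrite mulrC -ltr_pdivlMr// ltr_wpDl.
Qed.

(** The resolvent identity. *)
Lemma invmx_pencilB x y : pdmx (L x) -> pdmx (L y) ->
  invmx (L y) - invmx (L x) = - (invmx (L x) *m L (y - x) *m invmx (L y)).
Proof.
move=> /pdmx_unit ux /pdmx_unit uy; rewrite pencilB mulmxBr mulmxBl mulVmx//.
by rewrite mul1mx mulmxK// opprB.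
Qed.

(** The resolvent identity bounds the difference by p K |y - x| q, where p and q are the norms of
    the inverses at x and y. It also gives q <= p + p K |y - x| q, so q <= 2 p as soon as p K |y -
    x| <= 1/2. *)
Lemma invmx_pencil_lipschitz x : pdmx (L x) -> exists2 K, 0 <= K &
  \forall y \near x, mnorm (invmx (L y) - invmx (L x)) <= K * `|y - x|.
Proof.
move=> pdx; have [_ _ [K K0 bd]] := hL.
set p := mnorm (invmx (L x)); have p0 : 0 <= p by apply: mnorm_ge0.
have k1 : 0 < p * K + 1 by rewrite ltr_wpDl// mulr_ge0.
exists (p * K * (2 * p)); first by rewrite !mulr_ge0.
near=> y.
have pdy : pdmx (L y) by near: y; exact: pencil_near.
set q := mnorm (invmx (L y)).
have q0 : 0 <= q by apply: mnorm_ge0.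
have d0 : 0 <= `|y - x| by [].
have le1 : mnorm (invmx (L y) - invmx (L x)) <= p * (K * `|y - x|) * q.
  rewrite invmx_pencilB// mnormN (le_trans (mnormM _ _))// ler_wpM2r//.
  by rewrite (le_trans (mnormM _ _))// ler_wpM2l.
have le2 : q <= p + p * (K * `|y - x|) * q.
  have := mnormD (invmx (L x)) (invmx (L y) - invmx (L x)).
  by rewrite addrC subrK => /le_trans; apply; rewrite lerD2l.
have le3 : p * (K * `|y - x|) <= 2^-1.
  rewrite mulrA (@le_trans _ _ ((p * K + 1) * `|y - x|))//.
    by rewrite ler_wpM2r// lerDl.
  rewrite mulrC -ler_pdivlMr// ltW//; near: y.
  by apply: near_dist_lt; rewrite divr_gt0.
have le4 : q <= 2 * p.
  have : p * (K * `|y - x|) * q <= 2^-1 * q by rewrite ler_wpM2r.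
  by lra.
rewrite (le_trans le1)//.
rewrite [leRHS](_ : _ = p * (K * `|y - x|) * (2 * p)); last by ring.
by rewrite ler_wpM2l// !mulr_ge0.
Unshelve. all: by end_near. Qed.

Lemma word_bound x k : exists2 K, 0 <= K & forall ws, size ws = k ->
  mnorm (word L x ws) <= K * \prod_(w <- ws) `|w|.
Proof.
have [_ _ [K K0 bd]] := hL.
elim: k => [|k [K' K'0 IH]].
  exists (mnorm (1%:M : 'M[R[i]]_n)); first exact: mnorm_ge0.
  by move=> ws /size0nil ->; rewrite big_nil mulr1.
exists (mnorm (invmx (L x)) * K * K'); first by rewrite !mulr_ge0 ?mnorm_ge0.
case=> [//|v ws] [/IH le_ws]; rewrite big_cons /=.
rewrite (le_trans (mnormM _ _))//.
rewrite (@le_trans _ _ (mnorm (invmx (L x)) * (K * `|v|) *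
  (K' * \prod_(w <- ws) `|w|)))//.
  rewrite ler_pM ?mnorm_ge0// (le_trans (mnormM _ _))//.
  by rewrite ler_wpM2l ?mnorm_ge0.
by rewrite le_eqVlt; apply/orP; left; apply/eqP; ring.
Qed.

(** Induction on the length by telescoping one letter. The neighbourhood and the constant do not
    depend on the letters, as continuity in the operator norm demands. *)
Lemma word_lipschitz x k : pdmx (L x) -> exists2 K, 0 <= K &
  \forall y \near x, forall ws, size ws = k ->
    mnorm (word L y ws - word L x ws) <= K * `|y - x| * \prod_(w <- ws) `|w|.
Proof.
move=> pdx; have [_ _ [K K0 bd]] := hL.
elim: k => [|k [K2 K20 IH]].
  exists 0 => //; near=> y => ws /size0nil ->.
  by rewrite subrr mnorm0 !mul0r.
have [K1 K10 lip] := invmx_pencil_lipschitz pdx.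
have [K3 K30 bdw] := word_bound x k.
set p := mnorm (invmx (L x)); have p0 : 0 <= p by apply: mnorm_ge0.
exists (K1 * K * K3 + K1 * K * K2 + p * K * K2).
  by rewrite !addr_ge0// !mulr_ge0.
near=> y.
have leW ws : size ws = k ->
    mnorm (word L y ws - word L x ws) <= K2 * `|y - x| * \prod_(w <- ws) `|w|.
  by move: ws; near: y.
have leP : mnorm (invmx (L y) - invmx (L x)) <= K1 * `|y - x| by near: y.
have d1 : `|y - x| <= 1 by rewrite ltW//; near: y; exact: near_dist_lt.
case=> [//|v ws] [sz]; rewrite big_cons /=; move/(_ _ sz) in leW.
set q := \prod_(w <- ws) `|w| in leW *; set d := `|y - x| in leP leW d1 *.
have q0 : 0 <= q by apply: prodr_ge0.
have d0 : 0 <= d by exact: normr_ge0.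
have le0 : mnorm (word L x ws) <= K3 * q by apply: bdw.
set P := invmx (L x) in leP *; set P' := invmx (L y) in leP *.
set W := word L x ws in leW le0 *; set W' := word L y ws in leW *.
rewrite subr_mulmx3.
have b (A B : 'M[R[i]]_n) a c : mnorm A <= a -> mnorm B <= c ->
    mnorm (A *m L v *m B) <= a * (K * `|v|) * c.
  move=> hA hB; rewrite (le_trans (mnormM _ _))// ler_pM ?mnorm_ge0//.
  by rewrite (le_trans (mnormM _ _))// ler_pM ?mnorm_ge0.
have b1 := b _ _ _ _ leP le0.
have b2 := b _ _ _ _ leP leW.
have b3 := b _ _ _ _ (lexx p) leW.
rewrite (le_trans (mnormD _ _))// (le_trans (lerD (mnormD _ _) (lexx _)))//.
rewrite (le_trans (lerD (lerD b1 b2) b3))//.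
(* The only term quadratic in [d] is made linear by [d <= 1]. *)
have b4 : K1 * d * (K * `|v|) * (K2 * d * q) <=
    K1 * d * (K * `|v|) * (K2 * 1 * q).
  by rewrite !ler_wpM2l ?ler_wpM2r ?ler_wpM2l// !mulr_ge0.
rewrite (le_trans (lerD (lerD (lexx _) b4) (lexx _)))//.
by rewrite le_eqVlt; apply/orP; left; apply/eqP; ring.
Unshelve. all: by end_near. Qed.

(** Minus the sum of the insertions of y - x is the first-order change of the word. The induction
    peels off the first letter: inserting before it varies its inverse, and the remaining insertions
    vary the tail. *)
Lemma word_quadratic x ws : pdmx (L x) -> exists2 K, 0 <= K &
  \forall y \near x,
    mnorm (word L y ws - word L x ws +
           \sum_(w <- insertions (y - x) ws) word L x w) <= K * `|y - x| ^+ 2.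
Proof.
move=> pdx; have [_ _ [K K0 bd]] := hL.
elim: ws => [|v ws [K2 K20 IH]].
  by exists 0 => //; near=> y; rewrite /= big_nil addr0 subrr mnorm0 mul0r.
have [K1 K10 lip] := invmx_pencil_lipschitz pdx.
have [K3 K30 lipw] := word_lipschitz (size ws) pdx.
set p := mnorm (invmx (L x)); have p0 : 0 <= p by apply: mnorm_ge0.
set m := mnorm (L v); have m0 : 0 <= m by apply: mnorm_ge0.
set w0 := mnorm (word L x ws); have w00 : 0 <= w0 by apply: mnorm_ge0.
set q := \prod_(w <- ws) `|w|; have q0 : 0 <= q by apply: prodr_ge0.
(* One summand for each of the three terms of [word_remainder], in the same order. *)
exists (p * m * K2 + p * K * K1 * m * w0 + K1 * m * (K3 * q)).
  by rewrite !addr_ge0// !mulr_ge0.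
near=> y; rewrite /= big_cons big_map.
have pdy : pdmx (L y) by near: y; exact: pencil_near.
have leP : mnorm (invmx (L y) - invmx (L x)) <= K1 * `|y - x| by near: y.
have leW : mnorm (word L y ws - word L x ws) <= K3 * `|y - x| * q.
  by near: y; apply: filterS lipw => y; exact.
have leQ : mnorm (word L y ws - word L x ws +
    \sum_(w <- insertions (y - x) ws) word L x w) <= K2 * `|y - x| ^+ 2.
  by near: y.
set S := \sum_(w <- insertions _ _) _ in leQ.
set d := `|y - x| in leP leW leQ *; have d0 : 0 <= d by exact: normr_ge0.
rewrite (eq_bigr (fun w => invmx (L x) *m L v *m word L x w))// -mulmx_sumr.
rewrite -/S /=.
have eP : invmx (L x) *m L (y - x) *m (invmx (L y) - invmx (L x)) =
   - (invmx (L y) - invmx (L x) + invmx (L x) *m L (y - x) *m invmx (L x)).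
  by rewrite mulmxBr invmx_pencilB// opprD opprK.
set E := L (y - x) in eP *.
have leE : mnorm E <= K * d by apply: bd.
set P := invmx (L x) in leP eP *; set P' := invmx (L y) in leP eP *.
set W := word L x ws in leW leQ *; set W' := word L y ws in leW leQ *.
rewrite (word_remainder _ _ _ _ eP).
have h1 : mnorm (P *m L v *m (W' - W + S)) <= p * m * (K2 * d ^+ 2).
  rewrite (le_trans (mnormM _ _))// ler_pM ?mnorm_ge0//.
  exact: mnormM.
have h2 : mnorm (P *m E *m (P' - P) *m L v *m W) <=
    p * (K * d) * (K1 * d) * m * w0.
  do 3!rewrite (le_trans (mnormM _ _))// ler_pM ?mnorm_ge0//.
  by rewrite (le_trans (mnormM _ _))// ler_pM ?mnorm_ge0.
have h3 : mnorm ((P' - P) *m L v *m (W' - W)) <= K1 * d * m * (K3 * d * q).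
  rewrite (le_trans (mnormM _ _))// ler_pM ?mnorm_ge0//.
  by rewrite (le_trans (mnormM _ _))// ler_pM ?mnorm_ge0.
rewrite (le_trans (mnormD _ _))// (le_trans (lerD (mnormD _ _) (lexx _)))//.
rewrite mnormN (le_trans (lerD (lerD h1 h2) h3))//.
by rewrite le_eqVlt; apply/orP; left; apply/eqP; ring.
Unshelve. all: by end_near. Qed.

End Fixed.
End Pencil.

(** * Iterated derivatives from a family of candidates *)

Section DifferentialLemmas.
Context {R : realType} {V : normedModType R}.

Lemma is_diff_sum_seq I (r : seq I) (F dF : I -> V -> R^o) (x : V) :
  (forall i, is_diff x (F i) (dF i)) ->
  is_diff x (fun y => \sum_(i <- r) F i y) (fun h => \sum_(i <- r) dF i h).
Proof.
move=> dFx; elim: r => [|i r IH].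
  rewrite (_ : (fun y => _) = cst 0); last first.
    by apply/funext => y; rewrite big_nil.
  by apply: is_diff_eq; apply/funext => h; rewrite big_nil.
rewrite (_ : (fun y => _) = F i + (fun y => \sum_(j <- r) F j y)); last first.
  by apply/funext => y; rewrite big_cons.
by apply: is_diff_eq; apply/funext => h; rewrite big_cons.
Qed.

(** Differentiability depends only on the germ at x; this is used because [Dn f us] is identified
    only on an open set. *)
Lemma near_is_diff (f g df : V -> R^o) (x : V) :
  (\forall y \near x, f y = g y) -> is_diff x f df -> is_diff x g df.
Proof.
move=> fg dfx; have dE : 'd f x = df :> (V -> R^o) by exact: diff_val.
have H : g \o shift x = cst (g x) + 'd f x +o_ 0 id.
  apply/eqaddoP => e e0; rewrite near_simpl.
  have /eqaddoP/(_ e e0) := diff_locally (@ex_diff _ _ _ _ _ _ _ dfx).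
  rewrite near_simpl; move: (fg); rewrite (near_shift 0 x) subr0.
  apply: filterS2 => h fgh; apply: le_trans.
  have fgx : f x = g x by exact: nbhs_singleton fg.
  by rewrite /= !fctE /= -fgh /= -fgx.
have gE := diff_unique (diff_continuous (@ex_diff _ _ _ _ _ _ _ dfx)) H.
split; last by rewrite gE.
by apply/diff_locallyP; rewrite gE; split=> //; exact: diff_continuous.
Qed.

(** Induction on the directions: once [Dn f us] agrees with [G us] on the open set, it inherits the
    derivative of [G us], which is the next member of the family. *)
Lemma Dn_jet (D : set V) (f : V -> R) (G : seq V -> V -> R) : open D ->
  (forall x, D x -> G [::] x = f x) ->
  (forall us x, D x -> is_diff x (G us : V -> R^o) (fun h => G (h :: us) x)) ->
  forall us x, D x ->
    Dn f us x = G us x /\ differentiable (Dn f us : V -> R^o) x.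
Proof.
move=> oD Gf dG us x Dx.
have [E dE] : (forall y, D y -> Dn f us y = G us y) /\
    is_diff x (Dn f us : V -> R^o) (fun h => G (h :: us) x); last first.
  by split; [exact: E|exact: ex_diff].
elim: us x Dx => [|u us IH] x Dx.
  split=> [y Dy|]; first by rewrite Gf.
  apply: near_is_diff (dG _ _ Dx).
  by apply: filterS (open_nbhs_nbhs (conj oD Dx)) => y Dy; exact: Gf.
have E y : D y -> Dn f (u :: us) y = G (u :: us) y.
  by move=> Dy; have [_ dy] := IH y Dy; rewrite /= diff_val.
split=> //; apply: near_is_diff (dG _ _ Dx).
by apply: filterS (open_nbhs_nbhs (conj oD Dx)) => y Dy; rewrite E.
Qed.

End DifferentialLemmas.

(** * All derivatives of -ln det along a pencil *)

Section LogDetJet.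
Context {R : realType} {V : normedModType R} {n : nat}.
Variables (L : V -> 'M[R[i]]_n) (hL : hermitian_pencil L).
Implicit Types (x y u v : V) (us ws : seq V).
Local Notation retr M := (complex.Re (\tr M)).

Lemma retrD m (A B : 'M[R[i]]_m) : retr (A + B) = retr A + retr B.
Proof. by rewrite raddfD/= raddfD. Qed.

Lemma retrN m (A : 'M[R[i]]_m) : retr (- A) = - retr A.
Proof. by rewrite raddfN/= raddfN. Qed.

Lemma retrZ m a (A : 'M[R[i]]_m) : retr (a%:C *: A) = a * retr A.
Proof. by rewrite mxtraceZ ReZ. Qed.

Lemma retr_sum m I (r : seq I) (F : I -> 'M[R[i]]_m) :
  retr (\sum_(i <- r) F i) = \sum_(i <- r) retr (F i).
Proof.
by elim: r => [|i r IH]; rewrite ?big_nil ?mxtrace0// !big_cons retrD IH.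
Qed.

Lemma sum_insertions_linear x ws a u v :
  \sum_(w <- insertions (a *: u + v) ws) word L x w =
  a%:C *: (\sum_(w <- insertions u ws) word L x w) +
  \sum_(w <- insertions v ws) word L x w.
Proof.
elim: ws => [|z ws IH]; first by rewrite !big_nil scaler0 addr0.
rewrite /= !big_cons !big_map /=.
rewrite -!mulmx_sumr IH (pencilD hL) (pencilZ hL) scalerDr !mulmxDr !mulmxDl.
by rewrite -!scalemxAr -!scalemxAl addrACA.
Qed.

Lemma sum_insertions_bound x ws : exists K, forall u,
  mnorm (\sum_(w <- insertions u ws) word L x w) <= K * `|u|.
Proof.
have [K K0 bd] := word_bound hL x (size ws).+1.
exists ((size ws)%:R * K * \prod_(w <- ws) `|w|) => u.
rewrite (le_trans (mnorm_sum _ _))//.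
have <- : \sum_(w <- insertions u ws) (K * `|u| * \prod_(w <- ws) `|w|) =
    (size ws)%:R * K * \prod_(w <- ws) `|w| * `|u|.
  rewrite big_const_seq count_predT size_insertions iter_addr_0 -mulr_natl.
  by ring.
rewrite big_seq [leRHS]big_seq; apply: ler_sum => w hw.
have pw := perm_insertions hw.
have e : \prod_(i <- w) `|i| = `|u| * \prod_(i <- ws) `|i|.
  by rewrite (perm_big _ pw) big_cons.
by rewrite -mulrA -e bd// (perm_size pw).
Qed.

Lemma is_diff_word x ws : pdmx (L x) ->
  is_diff x ((fun y => retr (word L y ws)) : V -> R^o)
    (fun h => - \sum_(w <- insertions h ws) retr (word L x w)).
Proof.
move=> pdx; apply: is_diff_quadratic.
- move=> a u v; rewrite -!retr_sum sum_insertions_linear retrD retrZ.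
  by rewrite opprD mulrN.
- have [K hK] := sum_insertions_bound x ws; exists K => h.
  by rewrite normrN -retr_sum (le_trans (normr_Re_tr_le _)).
have [K _ hK] := word_quadratic hL ws pdx; exists K.
apply: filterS hK => y; apply: le_trans.
by rewrite opprK -retr_sum -retrN -!retrD normr_Re_tr_le.
Qed.

Lemma logdetD1 u x : logdetD L [:: u] x = - retr (invmx (L x) *m L u).
Proof. by rewrite /= big_seq1/= mulmx1 expr1 mulN1r. Qed.

(** The first-order inequality, used from x to y and from y to x, traps ln det L(y) - ln det L(x)
    between the traces of (L y)^-1 L(y - x) and (L x)^-1 L(y - x). These differ by O(|y - x|^2)
    since the inverse is Lipschitz at x, so the determinant itself is never differentiated. *)
Lemma is_diff_logdet x : pdmx (L x) ->
  is_diff x (logdetD L [::] : V -> R^o) (fun h => logdetD L [:: h] x).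
Proof.
move=> pdx; have [_ _ [K0 K00 bd]] := hL.
apply: is_diff_quadratic.
- move=> a u v; rewrite !logdetD1 (pencilD hL) (pencilZ hL) mulmxDr -scalemxAr.
  by rewrite retrD retrZ opprD mulrN.
- exists (mnorm (invmx (L x)) * K0) => h.
  rewrite logdetD1 normrN (le_trans (normr_Re_tr_le _))// (le_trans (mnormM _ _))//.
  by rewrite -mulrA ler_wpM2l ?mnorm_ge0.
have [K K_ge0 lip] := invmx_pencil_lipschitz hL pdx.
exists (K * K0); near=> y.
have pdy : pdmx (L y) by near: y; exact: pencil_near.
have le1 : mnorm (invmx (L y) - invmx (L x)) <= K * `|y - x| by near: y.
have [_ + _] := ln_det_le pdx pdy; rewrite -(pencilB hL).
have [_ + _] := ln_det_le pdy pdx; rewrite -(pencilB hL).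
rewrite -(opprB y x) (pencilN hL) mulmxN retrN logdetD1 /=.
set ly := ln (complex.Re (\det (L y))); set lx := ln (complex.Re (\det (L x))).
set a := retr (invmx (L y) *m _); set b := retr (invmx (L x) *m _) => h1 h2.
have -> : - ly - - lx - - b = - (ly - lx - b) by ring.
rewrite normrN ler0_norm; last by lra.
have le2 : b - a <= K * K0 * `|y - x| ^+ 2.
  rewrite /b /a -retrN -retrD -mulNmx -mulmxDl -opprB mulNmx retrN.
  rewrite (le_trans (ler_norm _))// normrN (le_trans (normr_Re_tr_le _))//.
  rewrite (le_trans (mnormM _ _))//.
  rewrite (_ : K * K0 * _ = (K * `|y - x|) * (K0 * `|y - x|)); last by ring.
  by rewrite ler_pM ?mnorm_ge0.
by lra.
Unshelve. all: by end_near. Qed.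

Lemma is_diff_logdetD us x : pdmx (L x) ->
  is_diff x (logdetD L us : V -> R^o) (fun h => logdetD L (h :: us) x).
Proof.
move=> pdx; case: us => [|u us]; first exact: is_diff_logdet.
have dS := is_diff_sum_seq (words (u :: us)) (fun ws => is_diff_word ws pdx).
rewrite (_ : logdetD L (u :: us) = ((-1) ^+ (size us).+1 : R) *:
  ((fun y => \sum_(w <- words (u :: us)) retr (word L y w)) : V -> R^o));
  last first.
  by apply/funext => y; rewrite fctE.
apply: is_diff_eq; apply/funext => h.
rewrite fctE /logdetD [in RHS]words_cons// big_flatten big_map.
rewrite sumrN scalerN -[LHS]/(- ((-1) ^+ (size us).+1 * _)) /=.
by rewrite [in RHS]exprS mulN1r mulNr.
Qed.

(** For k+1 directions there are k! words, all permutations of the directions, so the uniform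
    Lipschitz bound for words applies with one and the same product of norms. *)
Lemma logdetD_continuous k x e : pdmx (L x) -> 0 < e ->
  \forall y \near x, forall us, size us = k.+1 ->
    `|logdetD L us y - logdetD L us x| <= e * \prod_(u <- us) `|u|.
Proof.
move=> pdx e0; have [K K0 lip] := word_lipschitz hL k.+1 pdx.
have k1 : 0 < k`!%:R * K + 1 by rewrite ltr_wpDl// mulr_ge0.
near=> y => us.
have hy : forall ws, size ws = k.+1 ->
    mnorm (word L y ws - word L x ws) <= K * `|y - x| * \prod_(w <- ws) `|w|.
  by near: y.
have dy : (k`!%:R * K + 1) * `|y - x| <= e.
  rewrite mulrC -ler_pdivlMr// ltW//; near: y.
  by apply: near_dist_lt; rewrite divr_gt0.
case: us => // u us [szu].
rewrite /logdetD -mulrBr normrM normrX normrN1 expr1n mul1r -sumrB.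
set q := \prod_(_ <- _) _; have q0 : 0 <= q by exact: prodr_ge0.
rewrite (le_trans (ler_norm_sum _ _ _))//.
rewrite (@le_trans _ _ (\sum_(w <- words (u :: us)) (K * `|y - x| * q)))//.
  rewrite big_seq [leRHS]big_seq; apply: ler_sum => w hw.
  have pw := perm_words hw.
  have qE : \prod_(i <- w) `|i| = q by rewrite /q (perm_big _ pw).
  rewrite -retrN -retrD (le_trans (normr_Re_tr_le _))// -qE.
  by apply: hy; rewrite (perm_size pw)/= szu.
rewrite big_const_seq count_predT size_words// iter_addr_0 -mulr_natl /= szu.
by rewrite mulrA ler_wpM2r// (le_trans _ dy)// mulrA ler_wpM2r// lerDl.
Unshelve. all: by end_near. Qed.

(** Strictness is conditioned on the matrices rather than on the points, because a pencil such as a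
    trace need not be injective. *)
Lemma logdet_first_order x y : pdmx (L x) -> pdmx (L y) ->
  logdetD L [::] x + logdetD L [:: y - x] x <= logdetD L [::] y /\
  (L x != L y ->
   logdetD L [::] x + logdetD L [:: y - x] x < logdetD L [::] y).
Proof.
move=> pdx pdy; have [_ + +] := ln_det_le pdx pdy; rewrite -(pencilB hL).
rewrite logdetD1 /logdetD; move: (ln _) (ln _) (retr _) => a b c h1 h2.
by split=> [|/h2]; lra.
Qed.

End LogDetJet.

(** * The trace inequality *)

Section TraceIdentity.
Context {K : comNzRingType} {R : realFieldType} {m : nat}.
Variables (f : 'M[K]_m -> R) (s' t' : K) (s t : R) (U W : 'M[K]_m).
Hypotheses (fD : {morph f : A B / A + B}) (fN : {morph f : A / - A}).
Hypotheses (fs : forall A, f (s' *: A) = s * f A)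
  (ft : forall A, f (t' *: A) = t * f A).
Hypothesis fC : forall A B, f (A *m B) = f (B *m A).

(** Here [f] stands for the real part of the trace, and [s'], [t'] for the real scalars s, t
    embedded in C. The right-hand side is the quadratic form as [words] unfolds it: six words of
    length 4, two of length 3 and one of length 2. *)
Lemma trace_form_ge0 (S := U *m W + W *m U) (N := U *m W - W *m U)
    (Z := s' *: S - t' *: W) : 0 <= f (Z *m Z) -> f (N *m N) <= 0 ->
  0 <= s ^+ 2 * ((-1) ^+ 4 * (f (U *m U *m W *m W) + (f (U *m U *m W *m W) +
      (f (U *m W *m U *m W) + (f (U *m W *m U *m W) +
      (f (W *m U *m U *m W) + (f (W *m U *m U *m W) + 0))))))) +
    3 * s * t * ((-1) ^+ 3 * (f (U *m W *m W) + (f (W *m U *m W) + 0))) +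
    3 / 2 * t ^+ 2 * ((-1) ^+ 2 * (f (W *m W) + 0)).
Proof.
have rot A B C D : f (A *m B *m C *m D) = f (B *m C *m D *m A).
  by rewrite -2!mulmxA fC !mulmxA.
have -> : f (Z *m Z) =
    s ^+ 2 * f (S *m S) - 2 * s * t * f (S *m W) + t ^+ 2 * f (W *m W).
  rewrite /Z mulmxBr !mulmxBl -!scalemxAl -!scalemxAr.
  by rewrite !(fD, fN, fs, ft) (fC W S); ring.
have UWWU : f (U *m W *m W *m U) = f (U *m U *m W *m W).
  by rewrite 3!rot.
have WUUW : f (W *m U *m U *m W) = f (U *m U *m W *m W) by rewrite rot.
have WUWU : f (W *m U *m W *m U) = f (U *m W *m U *m W) by rewrite rot.
have -> : f (S *m S) = 2 * (f (U *m W *m U *m W) + f (U *m U *m W *m W)).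
  by rewrite /S mulmxDr !mulmxDl !mulmxA !fD UWWU WUUW WUWU; ring.
have -> : f (N *m N) = 2 * (f (U *m W *m U *m W) - f (U *m U *m W *m W)).
  by rewrite /N mulmxBr !mulmxBl !mulmxA !(fD, fN) UWWU WUUW WUWU; ring.
have -> : f (S *m W) = f (U *m W *m W) + f (W *m U *m W).
  by rewrite /S mulmxDl fD.
rewrite WUUW; move: (f (U *m W *m U *m W)) (f (U *m U *m W *m W))
  (f (U *m W *m W)) (f (W *m U *m W)) (f (W *m W)) => a b c d e h1 h2.
(* This is 3/2 f(Z Z) - 1/2 s^2 f(N N), expressed in the cyclically reduced words. *)
rewrite [leRHS](_ : _ =
    3 / 2 * (s ^+ 2 * (2 * (a + b)) - 2 * s * t * (c + d) + t ^+ 2 * e) +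
    1 / 2 * (s ^+ 2 * (- (2 * (a - b))))); last by field.
have h3 : 0 <= s ^+ 2 * - (2 * (a - b)) by rewrite mulr_ge0 ?sqr_ge0 ?oppr_ge0.
by rewrite addr_ge0// mulr_ge0// divr_ge0.
Qed.
End TraceIdentity.

(** * The quadratic form for one log-determinant *)

Section VB.
Context {R : realType} {V : normedModType R} {n : nat}.
Variables (L : V -> 'M[R[i]]_n) (hL : hermitian_pencil L).
Local Notation retr M := (complex.Re (\tr M)).
(** When L x = B^* B, this equals B (L x)^-1 L(v) B^-1. It is thus a Hermitian matrix similar to the
    letter (L x)^-1 L(v), and traces of words may be computed with it. *)
Definition hat (B : 'M[R[i]]_n) v := (invmx B) ^t* *m L v *m invmx B.

Definition mxprod m (Ms : seq 'M[R[i]]_m) := foldr mulmx 1%:M Ms.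

Lemma mxprod_cons m (M : 'M[R[i]]_m) Ms : mxprod (M :: Ms) = M *m mxprod Ms.
Proof. by []. Qed.

Lemma mxprod2 m (M N : 'M[R[i]]_m) : mxprod [:: M; N] = M *m N.
Proof. by rewrite 2!mxprod_cons mulmx1. Qed.

Lemma mxprod3 m (M N Q : 'M[R[i]]_m) : mxprod [:: M; N; Q] = M *m N *m Q.
Proof. by rewrite mxprod_cons mxprod2 mulmxA. Qed.

Lemma mxprod4 m (M N Q T : 'M[R[i]]_m) :
  mxprod [:: M; N; Q; T] = M *m N *m Q *m T.
Proof. by rewrite mxprod_cons mxprod3 !mulmxA. Qed.

Lemma retr_word (B : 'M[R[i]]_n) x ws : B \in unitmx -> L x = B ^t* *m B ->
  retr (word L x ws) = retr (mxprod [seq hat B w | w <- ws]).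
Proof.
move=> uB Lx; have iL : invmx (L x) = invmx B *m (invmx B) ^t*.
  by rewrite Lx invmxM ?conjtr_unit// conjtr_inv.
suff -> : word L x ws = invmx B *m mxprod [seq hat B w | w <- ws] *m B.
  by rewrite mxtrace_mulC mulmxA mulmxV// mul1mx.
elim: ws => [|v ws IH]; first by rewrite mulmx1 mulVmx.
have -> : word L x (v :: ws) = invmx (L x) *m L v *m word L x ws by [].
rewrite map_cons mxprod_cons IH iL; move: (mxprod _) => F; rewrite /hat.
by move: ((invmx B) ^t*) (invmx B) (L v) => T' T X; rewrite !mulmxA.
Qed.

Lemma logdetD_mxprod (B : 'M[R[i]]_n) x u us : B \in unitmx ->
  L x = B ^t* *m B -> logdetD L (u :: us) x = (-1) ^+ (size us).+1 *
    \sum_(w <- words (u :: us)) retr (mxprod [seq hat B v | v <- w]).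
Proof.
by move=> uB Lx; rewrite -(eq_bigr _ (fun w _ => retr_word w uB Lx)).
Qed.

Lemma logdet_vb x u v (s t : R) : pdmx (L x) ->
  0 <= s ^+ 2 * logdetD L [:: u; u; v; v] x +
       3 * s * t * logdetD L [:: u; v; v] x +
       3 / 2 * t ^+ 2 * logdetD L [:: v; v] x.
Proof.
move=> /pdmx_decomp[B uB Lx]; have [_ hrm _] := hL.
have := hrm; move: (logdetD_mxprod v [:: v] uB Lx)
  (logdetD_mxprod u [:: v; v] uB Lx) (logdetD_mxprod u [:: u; v; v] uB Lx).
have hH w : (hat B w) ^t* = hat B w.
  by rewrite /hat !conjtrM hrm trmxCK mulmxA.
move: (logdetD _ _ _) (logdetD _ _ _) (logdetD _ _ _) => D4 D3 D2.
rewrite ![words _]/= !big_cons !big_nil !map_cons ![map _ [::]]/=.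
move: (hat B u) (hat B v) (hH u) (hH v) => U W hU hW.
rewrite mxprod2 !mxprod3 !mxprod4 ![size _]/= => -> -> -> _.
clear - hU hW.
pose S := U *m W + W *m U; pose N := U *m W - W *m U.
pose Z := s%:C *: S - t%:C *: W.
have hS : S ^t* = S by rewrite /S conjtrD !conjtrM hU hW addrC.
have hN : N ^t* = - N by rewrite /N conjtrB !conjtrM hU hW opprB.
have hZ : Z ^t* = Z by rewrite /Z conjtrB !conjtrZ hS hW.
exact: (@trace_form_ge0 _ _ _ (fun M => retr M) s%:C t%:C s t U W
  (@retrD _ _) (@retrN _ _) (@retrZ _ _ s) (@retrZ _ _ t)
  (fun M N => congr1 (@complex.Re R) (mxtrace_mulC M N))
  (Re_tr_sqr_ge0 hZ) (Re_tr_sqr_le0 hN)).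
Qed.
End VB.

(** * VB-convexity from a family of derivatives *)

Section BarrierJet.
Context {R : realType} {V : normedModType R}.
Implicit Types (D : set V) (G : seq V -> V -> R).

(** Everything proved about the derivatives, in a form stable under sums and nonnegative multiples.
    The tangent inequality is weak so that the zero family and the trace terms qualify too. *)
Definition barrier_jet D G := [/\
  forall us x, D x -> is_diff x (G us : V -> R^o) (fun h => G (h :: us) x),
  forall k x e, D x -> 0 < e -> \forall y \near x, forall us, size us = k.+1 ->
    `|G us y - G us x| <= e * \prod_(u <- us) `|u|,
  forall x y, D x -> D y -> G [::] x + G [:: y - x] x <= G [::] y &
  forall x u v s t, D x ->
    0 <= s ^+ 2 * G [:: u; u; v; v] x + 3 * s * t * G [:: u; v; v] x +
         3 / 2 * t ^+ 2 * G [:: v; v] x].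

Lemma barrier_jet0 D : barrier_jet D (fun _ _ => 0).
Proof.
split=> [us x _|k x e _ e0|x y _ _|x u v s t _].
- exact: (is_diff_cst (0 : R^o) x).
- apply: nearW => y us _; rewrite subrr normr0.
  apply: mulr_ge0; first exact: ltW.
  exact: prodr_ge0.
- by rewrite addr0.
- by rewrite !mulr0 !addr0.
Qed.

Lemma barrier_jetD D G1 G2 : barrier_jet D G1 -> barrier_jet D G2 ->
  barrier_jet D (fun us x => G1 us x + G2 us x).
Proof.
move=> [d1 c1 f1 v1] [d2 c2 f2 v2].
split=> [us x Dx|k x e Dx e0|x y Dx Dy|x u v s t Dx].
- by have a := d1 us x Dx; have b := d2 us x Dx; exact: is_diffD.
- have e2 : 0 < e / 2 by rewrite divr_gt0.
  apply: filterS2 (c1 k x _ Dx e2) (c2 k x _ Dx e2) => y h1 h2 us sz.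
  rewrite opprD addrACA (le_trans (ler_normD _ _))//.
  by rewrite (le_trans (lerD (h1 _ sz) (h2 _ sz)))// -mulrDl -splitr.
- by rewrite addrACA lerD ?f1 ?f2.
- by have := v1 x u v s t Dx; have := v2 x u v s t Dx; lra.
Qed.

Lemma barrier_jetZ D G c : 0 <= c -> barrier_jet D G ->
  barrier_jet D (fun us x => c * G us x).
Proof.
move=> c0 [d1 c1 f1 v1]; split=> [us x Dx|k x e Dx e0|x y Dx Dy|x u v s t Dx].
- by have a := d1 us x Dx; exact: is_diffZ.
- have c10 : 0 < c + 1 by rewrite ltr_wpDl.
  have e2 : 0 < e / (c + 1) by rewrite divr_gt0.
  apply: filterS (c1 k x _ Dx e2) => y h1 us sz.
  rewrite -mulrBr normrM ger0_norm//.
  rewrite (@le_trans _ _ ((c + 1) * `|G us y - G us x|))//.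
    by rewrite ler_wpM2r// lerDl.
  by rewrite mulrC -ler_pdivlMr// mulrAC h1.
- by rewrite -mulrDr ler_wpM2l ?f1.
- rewrite (_ : _ + _ = c * (s ^+ 2 * G [:: u; u; v; v] x +
    3 * s * t * G [:: u; v; v] x + 3 / 2 * t ^+ 2 * G [:: v; v] x));
    last by ring.
  by rewrite mulr_ge0 ?v1.
Qed.

Lemma barrier_jet_sum D (I : Type) (r : seq I) (G : I -> seq V -> V -> R) :
  (forall i, barrier_jet D (G i)) ->
  barrier_jet D (fun us x => \sum_(i <- r) G i us x).
Proof.
move=> bG; elim: r => [|i r IH].
  rewrite (_ : (fun us x => _) = fun _ _ => 0); first exact: barrier_jet0.
  by apply/funext => us; apply/funext => x; rewrite big_nil.
rewrite (_ : (fun us x => _) = fun us x => G i us x + \sum_(j <- r) G j us x).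
  exact: barrier_jetD.
by apply/funext => us; apply/funext => x; rewrite big_cons.
Qed.

Lemma barrier_jet_logdet D n (L : V -> 'M[R[i]]_n) : hermitian_pencil L ->
  (forall x, D x -> pdmx (L x)) -> barrier_jet D (logdetD L).
Proof.
move=> hL DL; split=> [us x /DL|k x e /DL|x y /DL pdx /DL pdy|x u v s t /DL].
- exact: is_diff_logdetD.
- exact: logdetD_continuous.
- by have [] := logdet_first_order hL pdx pdy.
- exact: logdet_vb.
Qed.

(* Nonnegativity of the quadratic form in [s, t] bounds its discriminant; it is
   the formulation of the inequality that is visibly stable under sums. *)
Lemma discriminant_le (a b c : R) :
  (forall s t, 0 <= s ^+ 2 * a + 3 * s * t * c + 3 / 2 * t ^+ 2 * b) ->
  3 / 2 * c ^+ 2 <= a * b.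
Proof.
move=> h; have b0 : 0 <= b by have := h 0 1; lra.
have a0 : 0 <= a by have := h 1 0; lra.
have [b0'|bn0] := eqVneq b 0; last first.
  have bp : 0 < b by rewrite lt_neqAle eq_sym bn0.
  (* The point (b, -c) minimises the form along its ray and yields b times the discriminant
     bound. *)
  have := h b (- c).
  rewrite (_ : _ + _ = b * (a * b - 3 / 2 * c ^+ 2)); last by field.
  by rewrite pmulr_rge0// subr_ge0.
suff -> : c = 0 by rewrite b0' expr0n/= !mulr0.
apply/eqP; apply: contraT => c0.
(* For b = 0 the form is linear in t, and this t brings it down to -1. *)
have := h 1 (- (a + 1) / (3 * c)); rewrite b0' (_ : _ + _ = -1).
  by rewrite oppr_ge0 ler10.
by field.
Qed.

(** Strict convexity follows from the strict tangent inequalities at the intermediate point z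
    towards x and y; the fourth-order inequality is the discriminant of the quadratic form. *)
Lemma VB_convex_jet D (phi : V -> \bar R) (G : seq V -> V -> R) :
  open D -> barrier_jet D G ->
  (forall x, D x -> phi x = (G [::] x)%:E) ->
  (forall x, ~ D x -> phi x = +oo%E) ->
  (forall (x y : V) (s : R), D x -> D y -> 0 < s -> s < 1 ->
    D (s *: x + (1 - s) *: y)) ->
  (forall x y, D x -> D y -> x != y -> G [::] x + G [:: y - x] x < G [::] y) ->
  VB_convex phi.
Proof.
move=> oD [dG cG _ vG] phiD phiN convD strictG.
have domE : edom phi = D.
  apply/seteqP; split=> x; rewrite /edom /=; last first.
    by move=> Dx; rewrite phiD// ltry.
  by move=> xoo; apply: contrapT => /phiN e; rewrite e ltxx in xoo.
have DnE := @Dn_jet _ _ D (fine \o phi) G oD.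
have {}DnE us x : D x -> Dn (fine \o phi) us x = G us x /\
    differentiable (Dn (fine \o phi) us : V -> R^o) x.
  by apply: DnE => // y Dy; rewrite /= phiD.
split.
- move=> x; have [Dx|nDx] := pselect (D x); first by rewrite phiD// ltNyr.
  by rewrite phiN.
- rewrite domE; split=> // [x Dx us _|x Dx e e0].
    by have [] := DnE us x Dx.
  have nD : \forall y \near x, D y by exact: open_nbhs_nbhs.
  (* The index 3 stands for four directions, as the continuity clause counts [k.+1]. *)
  apply: filterS2 (cG 3 x e Dx e0) nD => y h Dy us.
  rewrite (DnE us y Dy).1 (DnE us x Dx).1; apply: h.
  exact: size_tuple.
- move=> x y s; rewrite domE => Dx Dy xy s0 s1.
  pose z := s *: x + (1 - s) *: y.
  have Dz : D z by exact: convD.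
  rewrite -/z !phiD// -!EFinM -EFinD lte_fin.
  have s1' : 0 < 1 - s by rewrite subr_gt0.
  have xz : x - z = (1 - s) *: (x - y).
    rewrite /z opprD addrA [in RHS]scalerBr; congr (_ - _).
    by rewrite scalerBl scale1r.
  have yz : y - z = (- s) *: (x - y).
    rewrite /z scaleNr -scalerN opprB [in RHS]scalerBr opprD addrCA addrC.
    by congr (_ - _); rewrite scalerBl scale1r opprB addrC subrK.
  have xny : x - y != 0 by rewrite subr_eq0.
  have zx : z != x.
    by rewrite eq_sym -subr_eq0 xz scaler_eq0 negb_or gt_eqF.
  have zy : z != y.
    by rewrite eq_sym -subr_eq0 yz scaler_eq0 negb_or oppr_eq0 gt_eqF.
  have := strictG _ _ Dz Dx zx; have := strictG _ _ Dz Dy zy.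
  rewrite xz yz; have dz := dG [::] z Dz.
  have GE h : G [:: h] z = 'd (G [::] : V -> R^o) z h by rewrite diff_val.
  have GZ k h : G [:: k *: h] z = k * G [:: h] z by rewrite !GE linearZ.
  rewrite !GZ => h1 h2.
  (* Weighted by 1 - s and s, the first-order terms of the two tangent inequalities cancel. *)
  rewrite -(ltr_pM2l s1') in h1; rewrite -(ltr_pM2l s0) in h2.
  rewrite (_ : G [::] z = (1 - s) * (G [::] z + - s * G [:: x - y] z) +
    s * (G [::] z + (1 - s) * G [:: x - y] z)); last by ring.
  by rewrite [ltRHS]addrC ltrD.
- move=> x u v; rewrite domE => Dx.
  rewrite !(DnE _ _ Dx).1; apply: discriminant_le => s t.
  exact: vG.
Qed.

End BarrierJet.

(** * The cumulative loss *)

Section Pencils.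
Context {R : realType} {d : nat}.
Local Notation C := R[i].
Local Notation retr M := (complex.Re (\tr M)).

Definition hvmx (v : @hermvec R d) : 'M[C]_d := uncolvec (val v).

Lemma hvmx_inj : injective hvmx.
Proof. by move=> u v /(can_inj (@uncolvecK _ _)) /val_inj. Qed.

Lemma hvmx_linear : linear_for (real_complex R \; *:%R) hvmx.
Proof. by move=> a u v; rewrite /hvmx linearP. Qed.

Lemma hvmx_herm v : (hvmx v) ^t* = hvmx v.
Proof. exact/hermsymmxP/(valP v). Qed.

Lemma normc_hermvec_le (v : @hermvec R d) k :
  ComplexField.Normc.normc (val v k 0) <= `|v|.
Proof.
have -> : `|v| = hvnorm v by [].
rewrite /hvnorm hvdot_sum (bigD1 k)//=.
case: (val v k 0) => a b /=; rewrite ler_wsqrtr// lerDl sumr_ge0// => i _.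
by rewrite addr_ge0 ?sqr_ge0.
Qed.

Lemma mnorm_hvmx_le (v : @hermvec R d) : mnorm (hvmx v) <= (d * d)%:R * `|v|.
Proof.
rewrite /mnorm natrM -mulrA !mulr_natl -[X in _ *+ X]card_ord -sumr_const.
apply: ler_sum => i _; rewrite -[X in _ *+ X]card_ord -sumr_const.
by apply: ler_sum => j _; rewrite !mxE normc_hermvec_le.
Qed.

Lemma hvmx_pencil : hermitian_pencil hvmx.
Proof.
split; [exact: hvmx_linear|exact: hvmx_herm|exists (d * d)%:R => //].
exact: mnorm_hvmx_le.
Qed.

(** Taking the real part makes this matrix Hermitian by construction, and its entry is the argument
    of the logarithm in [log_loss]. *)
Definition trace_pencil (A : 'M[C]_d) (v : @hermvec R d) : 'M[C]_1 :=
  ((retr (A *m hvmx v))%:C)%:M.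

Lemma conjtr_real_scalar n (a : R) : ((a%:C)%:M : 'M[C]_n) ^t* = (a%:C)%:M.
Proof.
by rewrite tr_scalar_mx map_scalar_mx; congr (_%:M); exact: conjc_real.
Qed.

Lemma trace_pencilP (A : 'M[C]_d) : hermitian_pencil (trace_pencil A).
Proof.
split=> [a u v|v|]; last exists (mnorm A * (d * d)%:R).
- rewrite /trace_pencil hvmx_linear /= mulmxDr -scalemxAr retrD retrZ.
  by rewrite rmorphD rmorphM raddfD/= scale_scalar_mx.
- exact: conjtr_real_scalar.
- by rewrite mulr_ge0 ?mnorm_ge0.
move=> v; rewrite /mnorm !big_ord1 mxE eqxx mulr1n.
have -> : ComplexField.Normc.normc (retr (A *m hvmx v))%:C =
    `|retr (A *m hvmx v)|.
  by rewrite /= expr0n/= addr0 sqrtr_sqr.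
rewrite (le_trans (normr_Re_tr_le _))// (le_trans (mnormM _ _))//.
by rewrite -mulrA ler_wpM2l ?mnorm_ge0// mnorm_hvmx_le.
Qed.

Lemma pdmx_real_scalar1 (a : R) : pdmx ((a%:C)%:M : 'M[C]_1) <-> 0 < a.
Proof.
split=> [pd|a0].
  (* Only the positivity of the determinant is extracted, by comparing the matrix with itself. *)
  by have [] := ln_det_le pd pd; rewrite det_scalar1.
split; first by apply/hermsymmxP; exact: conjtr_real_scalar.
move=> x x0; rewrite mul_mx_scalar -scalemxAl mxE mulr_gt0 ?ltcR//.
exact: conjtr_mul_gt0.
Qed.

Lemma pdmx_comb n (X Y : 'M[C]_n) (s : R) :
  pdmx X -> pdmx Y -> 0 < s -> s < 1 ->
  pdmx (s%:C *: X + (1 - s)%:C *: Y).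
Proof.
move=> [/hermsymmxP hX pX] [/hermsymmxP hY pY] s0 s1; split.
  by apply/hermsymmxP; rewrite conjtrD !conjtrZ hX hY.
move=> x x0; rewrite mulmxDr mulmxDl -!scalemxAr -!scalemxAl.
rewrite mxE [X in X + _]mxE [X in _ + X]mxE.
by rewrite addr_gt0 ?mulr_gt0 ?pX ?pY// ltcR ?subr_gt0.
Qed.

Lemma pencil_comb (V : normedModType R) n (L : V -> 'M[C]_n) x y s :
  hermitian_pencil L -> pdmx (L x) -> pdmx (L y) -> 0 < s -> s < 1 ->
  pdmx (L (s *: x + (1 - s) *: y)).
Proof.
move=> hL pdx pdy s0 s1.
by rewrite (pencilD hL) !(pencilZ hL); exact: pdmx_comb.
Qed.

Lemma log_loss_gtNy (A rho : 'M[C]_d) : (-oo < log_loss A rho)%E.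
Proof.
rewrite /log_loss; have [a0|a0] := leP (retr (A *m rho)) 0.
  by rewrite le0_lneNy ?lee_fin.
by rewrite lne_EFin// ltNyr.
Qed.

End Pencils.

(** * The effective domain of the loss and its family of derivatives *)

Section CumulativeLoss.
Context {R : realType} {d t : nat}.
Variables (A : 'I_t -> 'M[R[i]]_d) (lambda : R) (lambda_gt0 : 0 < lambda).
Local Notation phi := (overline (cumulative_loss A lambda)).

(** The second condition says that all tr(A_tau rho) are positive; if some A_tau is zero, the domain
    is empty. *)
Definition loss_dom : set (@hermvec R d) := [set v | pdmx (hvmx v) /\
  forall tau, pdmx (trace_pencil (A tau) v)].

Definition loss_jet (us : seq (@hermvec R d)) (v : @hermvec R d) : R :=
  \sum_(tau < t) logdetD (trace_pencil (A tau)) us v +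
  lambda * logdetD hvmx us v.

Lemma loss_dom_open : open loss_dom.
Proof.
rewrite openE => x [pdx pdA]; rewrite /interior /=.
have h0 := pencil_near hvmx_pencil pdx.
have hA tau : \forall y \near x, pdmx (trace_pencil (A tau) y).
  exact: (pencil_near (trace_pencilP (A tau)) (pdA tau)).
have hA' : \forall y \near x, forall tau, pdmx (trace_pencil (A tau) y).
  exact: (@filter_forall _ _ (fun tau y => pdmx (trace_pencil (A tau) y)) _
    (nbhs_filter x) hA).
by apply: filterS2 h0 hA' => y py pAy; split.
Qed.

Lemma loss_finite v : loss_dom v -> phi v = (loss_jet [::] v)%:E.
Proof.
move=> [pdv pdA]; rewrite /overline /cumulative_loss /loss_jet EFinD EFinM.
congr (_ + _)%E; last by rewrite /neg_logdet asboolT.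
rewrite -sumEFin; apply: eq_bigr => tau _.
have /pdmx_real_scalar1 a0 := pdA tau.
by rewrite /log_loss lne_EFin// /logdetD /trace_pencil det_scalar1.
Qed.

(** No term ever equals -oo, so a single infinite term, either the barrier or one logarithm, makes
    the sum +oo. *)
Lemma loss_infinite v : ~ loss_dom v -> phi v = +oo%E.
Proof.
move=> ndv; rewrite /overline /cumulative_loss.
have [pdv|npdv] := pselect (pdmx (hvmx v)); last first.
  rewrite /neg_logdet asboolF// gt0_muley ?lte_fin// addey//.
  rewrite -ltNye; apply: (big_ind (fun x => -oo < x)%E) => [|x y|tau _].
  - exact: ltNyr.
  - by move: x y => [a| |] [b| |]; rewrite //= ?ltNyr.
  - exact: log_loss_gtNy.
have [tau ntau] : exists tau, ~ pdmx (trace_pencil (A tau) v).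
  by apply/existsNP => h; apply: ndv.
rewrite [X in (X + _)%E](_ : _ = +oo%E).
  rewrite addye// gt_eqF//.
  by rewrite /neg_logdet asboolT// -EFinM ltNyr.
apply/esum_eqyP; first by move=> i _; rewrite gt_eqF// log_loss_gtNy.
exists tau; split=> //.
have a0 : complex.Re (\tr (A tau *m uncolvec (val v))) <= 0.
  rewrite leNgt; apply/negP => a0; apply: ntau; exact/pdmx_real_scalar1.
by rewrite /log_loss le0_lneNy// lee_fin.
Qed.

End CumulativeLoss.

Unset Implicit Arguments.

Theorem corollary2p10 (R : realType) (d t : nat) (A : 'I_t -> 'M[R[i]]_d)
    (lambda : R) (lambda_gt0 : 0 < lambda) (A_psd : forall tau, psdmx (A tau)) :
  VB_convex (overline (cumulative_loss A lambda)).
Proof.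
have pL := @hvmx_pencil R d.
have pA tau := trace_pencilP (A tau).
have D0 x : loss_dom A x -> pdmx (hvmx x) by case.
have DA tau x : loss_dom A x -> pdmx (trace_pencil (A tau) x) by case.
have bA : barrier_jet (loss_dom A)
    (fun us x => \sum_(tau < t) logdetD (trace_pencil (A tau)) us x).
  by apply: barrier_jet_sum => tau; exact: barrier_jet_logdet (DA tau).
apply: (@VB_convex_jet _ _ (loss_dom A) _ (loss_jet A lambda)).
- exact: loss_dom_open.
- have bL := barrier_jetZ (ltW lambda_gt0) (barrier_jet_logdet pL D0).
  exact: (barrier_jetD bA bL).
- exact: loss_finite.
- exact: loss_infinite.
- move=> x y s [px ptx] [py pty] s0 s1.
  by split=> [|tau]; exact: pencil_comb.
move=> x y Dx Dy xy; rewrite /loss_jet addrACA -mulrDr.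
have [_ _ fA _] := bA.
(* The trace terms give only a weak inequality; strictness comes from the term with [lambda], whose
   pencil [hvmx] is injective. *)
rewrite ler_ltD ?fA// ltr_pM2l//.
have [_] := logdet_first_order pL (D0 x Dx) (D0 y Dy); apply.
by apply: contra xy => /eqP /hvmx_inj ->.
Qed.
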